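(* Let $b$ be prime, $s_1,s_2$ positive integers, $U_i=[0,1]^{s_i}$ for $i=1,2$. Let $\boldsymbol{\chi}=(\chi_j)_{j\ge1}$ and $\boldsymbol{\varphi}=(\varphi_j)_{j\ge1}$ be sequences of positive numbers with $\sum_{j\ge1}\chi_j^p$ and $\sum_{j\ge1}\varphi_j^q$ finite for some $0<p,q<1$. Let $\boldsymbol{\chi}_{s_1}=(\chi_j)_{1\le j\le s_1}$, $\boldsymbol{\varphi}_{s_2}=(\varphi_j)_{1\le j\le s_2}$, $\alpha:=\lfloor1/p\rfloor+1$ and $\beta:=\lfloor1/q\rfloor+1$. Assume that $F:U_1\times U_2\to\mathbb{R}$ satisfies, for any $\mathbf{y}\in U_1$, $\mathbf{z}\in U_2$, $\boldsymbol{\alpha}\in\{0,1,\dots,\alpha\}^{s_1}$ and $\boldsymbol{\beta}\in\{0,1,\dots,\beta\}^{s_2}$, $$|\partial^{\boldsymbol{\alpha}}_{\mathbf{y}}F(\mathbf{y},\mathbf{z})|\le c\,|\boldsymbol{\alpha}|!\,\boldsymbol{\chi}_{s_1}^{\boldsymbol{\alpha}}\quad\text{and}\quad|\partial^{\boldsymbol{\beta}}_{\mathbf{z}}F(\mathbf{y},\mathbf{z})|\le c\,|\boldsymbol{\beta}|!\,\boldsymbol{\varphi}_{s_2}^{\boldsymbol{\beta}},$$ where the constant $c$ is independent of $\mathbf{y},\mathbf{z},s_1,s_2$ and of $p$ and $q$. Let $\vartheta>0$ be such that $p\vartheta,q\vartheta\ge1$, and for $j\ge1$ let $N_1^{(j)}=b^{\lceil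 jp\vartheta\rceil}$ and $N_2^{(j)}=b^{\lceil jq\vartheta\rceil}$. Then one can construct interlaced polynomial lattice rules of order $\alpha$ with $N_1^{(j)}$ points in $U_1$ and of order $\beta$ with $N_2^{(j)}$ points in $U_2$ ($j\ge1$) such that the associated QMC sparse grid approximation $\mathcal{I}_{\mathbf{s},L}[F]$ of level $L$ (an integer $L\ge2$) satisfies $$|\mathcal{I}_{\mathbf{s}}F-\mathcal{I}_{\mathbf{s},L}[F]|\le C\,b^{-L\vartheta/2},$$ where the constant $C$ depends on $b,p,q,\vartheta$ (and on $c,\boldsymbol{\chi},\boldsymbol{\varphi}$), but is independent of $s_1,s_2$ and $L$. Furthermore, if $M$ denotes the total number of quadrature points used in the QMC sparse grid rule, then $$|\mathcal{I}_{\mathbf{s}}F-\mathcal{I}_{\mathbf{s},L}[F]|\le C(\log M)^{1_{p=q}/(2p)}M^{-\min(1/p,1/q)/2},$$ where $1_{p=q}$ is $1$ if $p=q$ and $0$ otherwise, and where the constant $C$ depends on $b,p,q,\vartheta$ (and on $c,\boldsymbol{\chi},\boldsymbol{\varphi}$), but is independent of $s_1,s_2$ and $M$.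
   Context: For $\mathbf{s}=(s_1,s_2)$: $\mathcal{I}_{\mathbf{s}}F=\int_{U_2}\int_{U_1}F(\mathbf{y},\mathbf{z})\,d\mathbf{y}\,d\mathbf{z}$. For $j,k\ge1$ and $\mathbf{N}^{j,k}=(N_1^{(j)},N_2^{(k)})$, $Q_{\mathbf{s},\mathbf{N}^{j,k}}[F]$ is the tensor product equal-weight rule $\frac1{N_1^{(j)}N_2^{(k)}}\sum_{\mathbf{z}}\sum_{\mathbf{y}}F(\mathbf{y},\mathbf{z})$, where $\mathbf{y}$ runs over the points of the rule with $N_1^{(j)}$ points in $U_1$ and $\mathbf{z}$ over those of the rule with $N_2^{(k)}$ points in $U_2$; $Q_{\mathbf{s},\mathbf{N}^{j,k}}=0$ if $j=0$ or $k=0$. The QMC sparse grid approximation of level $L$ is $$\mathcal{I}_{\mathbf{s},L}[F]=\sum_{k=1}^{L-1}\Big(Q_{\mathbf{s},\mathbf{N}^{L-k,k}}[F]-Q_{\mathbf{s},\mathbf{N}^{L-k,k-1}}[F]\Big),$$ and its total number of quadrature points is counted as $M=\sum_{k=1}^{L-1}N_1^{(L-k)}N_2^{(k)}$. For a multi-index, $|\boldsymbol{\alpha}|=\sum_j\alpha_j$, $\boldsymbol{\chi}_{s_1}^{\boldsymbol{\alpha}}=\prod_{j=1}^{s_1}\chi_j^{\alpha_j}$, and similarly for $\boldsymbol{\varphi}_{s_2}^{\boldsymbol{\beta}}$; $\partial_{\mathbf{y}}^{\boldsymbol{\alpha}}$ is the mixed partial derivative of order $\alpha_j$ in $y_j$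 (similarly $\partial_{\mathbf{z}}^{\boldsymbol{\beta}}$). Interlaced polynomial lattice rules: let $\mathbb{Z}_b$ be the field with $b$ elements, $P\in\mathbb{Z}_b[x]$ irreducible of degree $m$, and $\mathbf{g}=(g_1,\dots,g_t)$ a vector of polynomials over $\mathbb{Z}_b$ of degree less than $m$ (generating vector). For $0\le n\le b^m-1$ with $b$-adic expansion $n=\sum_{i=1}^m\eta_{i-1}b^{i-1}$ let $n(x)=\sum_{i=1}^m\eta_{i-1}x^{i-1}$, and for a formal Laurent series put $v_m(\sum_{\ell\ge w}t_\ell x^{-\ell})=\sum_{\ell=\max(1,w)}^mt_\ell b^{-\ell}$. The polynomial lattice rule $\mathcal{S}_{P,b,m,t}(\mathbf{g})$ consists of the points $(v_m(n(x)g_j(x)/P(x)))_{1\le j\le t}\in[0,1)^t$, $0\le n<b^m$. The digit interlacing function with factor $\alpha\in\mathbb{N}$ is $\mathscr{D}_\alpha(x_1,\dots,x_\alpha)=\sum_{i\ge1}\sum_{j=1}^\alpha\xi_{j,i}b^{-j-(i-1)\alpha}$ where $x_j=\sum_{i\ge1}\xi_{j,i}b^{-i}$; applied to consecutive blocks of $\alpha$ coordinates it gives a map $[0,1)^{\alpha s}\to[0,1)^s$. An interlaced polynomial lattice rule of order $\alpha$ with $b^m$ points in $s$ dimensions is the equal-weight rule whose points are the images under this map of $\mathcal{S}_{P,b,m,\alpha s}(\mathbf{g})$. *)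

(* Defs.v *)
From HB Require Import structures.
From mathcomp Require Import all_boot all_order all_algebra.
From mathcomp Require Import all_classical all_reals all_analysis.

Set Implicit Arguments.
Unset Strict Implicit.
Unset Printing Implicit Defensive.

Import Order.TTheory GRing.Theory Num.Theory.
Import numFieldNormedType.Exports.

Local Open Scope classical_set_scope.
Local Open Scope ring_scope.

Definition cube (R : realType) (s : nat) : set 'rV[R]_s :=
  [set y | forall j, 0 <= y 0 j <= 1].

Definition cons_tuple d (T : measurableType d) (n : nat)
    (xt : T * n.-tuple T) : n.+1.-tuple T := [tuple of xt.1 :: xt.2].

Lemma measurable_cons_tuple d (T : measurableType d) (n : nat) :
  measurable_fun setT (@cons_tuple d T n).
Proof. by apply: measurable_cons. Qed.

HB.instance Definition _ d (T : measurableType d) (n : nat) :=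
  isMeasurableFun.Build _ _ _ _ (@cons_tuple d T n)
    (@measurable_cons_tuple d T n).

(* Lebesgue measure on [0,1]^n, as the n-fold product of the Lebesgue measure
   on [0,1]. *)
Fixpoint cube_measure (R : realType) (n : nat) :
    probability (n.-tuple (measurableTypeR R)) R :=
  match n with
  | 0 => \d_([tuple] : 0.-tuple (measurableTypeR R))
  | n'.+1 => distribution (uniform_prob (@ltr01 R) \x cube_measure R n')%E
               (@cons_tuple _ (measurableTypeR R) n')
  end.

Definition row_of_tuple (R : realType) (s : nat)
    (t : s.-tuple (measurableTypeR R)) : 'rV[R]_s := \row_j tnth t j.

Definition cube_integral (R : realType) (s : nat) (f : 'rV[R]_s -> R) : R :=
  (\int[cube_measure R s]_(t in [set t | cube (row_of_tuple t)])
     f (row_of_tuple t))%R.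

Definition integral2 (R : realType) (s1 s2 : nat)
    (F : 'rV[R]_s1 -> 'rV[R]_s2 -> R) : R :=
  cube_integral (fun z => cube_integral (fun y => F y z)).

(* Derivatives of functions on the closed cube: the increments are those that
   stay in the cube, so the derivative is one-sided on the boundary, and values
   of [f] outside the cube play no role. *)
Definition cube_steps (R : realType) (s : nat) (j : 'I_s) (y : 'rV[R]_s) :=
  within [set h : R | cube (y + h *: delta_mx 0 j)] (0 : R)^'.

Definition diff_quot (R : realType) (s : nat) (j : 'I_s) (f : 'rV[R]_s -> R)
    (y : 'rV[R]_s) (h : R) : R :=
  h^-1 * (f (y + h *: delta_mx 0 j) - f y).

Definition pderivable (R : realType) (s : nat) (j : 'I_s)
    (f : 'rV[R]_s -> R) (y : 'rV[R]_s) : Prop :=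
  cvg (diff_quot j f y h @[h --> cube_steps j y]).

Definition pderive (R : realType) (s : nat) (j : 'I_s)
    (f : 'rV[R]_s -> R) (y : 'rV[R]_s) : R :=
  lim (diff_quot j f y h @[h --> cube_steps j y]).

Definition multi_index (s : nat) := {ffun 'I_s -> nat}.

Definition mixed_pderive (R : realType) (s : nat) (nu : multi_index s)
    (f : 'rV[R]_s -> R) : 'rV[R]_s -> R :=
  foldr (fun j g => iter (nu j) (pderive j) g) f (enum 'I_s).

Definition mi_succ (s : nat) (nu : multi_index s) (j : 'I_s) : multi_index s :=
  [ffun i => (nu i + (i == j))%N].

(* All mixed partial derivatives of order at most [a] in each variable exist on
   the closed cube and do not depend on the order of differentiation. *)
Definition has_mixed_pderives (R : realType) (s : nat) (a : nat)
    (f : 'rV[R]_s -> R) : Prop :=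
  forall (nu : multi_index s) (j : 'I_s) (y : 'rV[R]_s),
    (forall i, (nu i <= a)%N) -> (nu j < a)%N -> cube y ->
    pderivable j (mixed_pderive nu f) y /\
    pderive j (mixed_pderive nu f) y = mixed_pderive (mi_succ nu j) f y.

Definition mi_abs (s : nat) (nu : multi_index s) : nat := (\sum_j nu j)%N.

(* [chi] is indexed from 0: [chi j] is the (j+1)-st term of the sequence. *)
Definition mi_pow (R : realType) (s : nat) (chi : nat -> R)
    (nu : multi_index s) : R :=
  \prod_(j < s) chi j ^+ nu j.

(* A formal Laurent series in x^-1 is represented by [t : int -> K], where
   [t l] is the coefficient of x^(-l). *)
Definition laurent_frac (K : fieldType) (u P : {poly K}) (l : int) : K :=
  match l with
  | Posz k => (('X^k * u) %/ P)`_0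
  | Negz k => (u %/ P)`_k.+1
  end.

Definition laurent_of_poly (K : fieldType) (u : {poly K}) (l : int) : K :=
  if l <= 0 then u`_(absz l) else 0.

Lemma coef_divp_XnM (K : fieldType) (u P : {poly K}) (k i : nat) :
  P != 0 -> (('X^k * u) %/ P)`_(k + i) = (u %/ P)`_i.
Proof.
move=> P0.
rewrite {1}(divp_eq u P) mulrDr mulrA divpD mulpK // coefD mulrC coefMXn.
rewrite ltnNge leq_addr /= addKn [X in _ + X]nth_default ?addr0 //.
have lt_r : (size (u %% P)%R < size P)%N by rewrite ltn_modp.
have [->|r0] := eqVneq (u %% P) 0; first by rewrite ?(mul0r, mulr0) div0p size_poly0.
have le_r : (size (u %% P)%R <= (size P).-1)%N.
  by rewrite -ltnS prednK // lt0n size_poly_eq0.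
rewrite size_divp // leq_subLR (leq_trans (size_polyMleq _ _)) // size_polyXn.
by rewrite ?addnS ?addSn /= addnCA leq_add2l (leq_trans le_r) ?leq_addr.
Qed.

Lemma laurent_frac_shift (K : fieldType) (u P : {poly K}) (N : nat) (l : int) :
  P != 0 -> l <= N -> laurent_frac u P l = (('X^N * u) %/ P)`_(absz (N%:Z - l)).
Proof.
case: l => k P0; last first.
  by move=> _; rewrite NegzE opprK -PoszD absz_nat coef_divp_XnM.
rewrite lez_nat => kN; rewrite subzn // absz_nat /=.
by rewrite -{1}(subnK kN) exprD -mulrA -[LHS](coef_divp_XnM _ (N - k)) // addn0.
Qed.

(* [laurent_frac u P] is the Laurent expansion of u / P: it has finitely many
   terms of nonnegative exponent, and its product with P is u. *)
Lemma laurent_frac_bounded (K : fieldType) (u P : {poly K}) (l : int) :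
  l < - (size u)%:Z -> laurent_frac u P l = 0.
Proof.
case: l => k /=; first by rewrite ltNge (le_trans (y := 0)) // oppr_le0.
rewrite NegzE ltrN2 ltz_nat => hk.
by rewrite nth_default // (leq_trans (leq_divp _ _)) // ltnW.
Qed.

Lemma laurent_fracP (K : fieldType) (u P : {poly K}) (l : int) : P != 0 ->
  \sum_(i < size P) P`_i * laurent_frac u P (l + i%:Z) = laurent_of_poly u l.
Proof.
move=> P0; set N := (absz l + size P)%N.
have [M MlE] : exists M, N%:Z = l + M%:Z /\ (size P <= M)%N.
  case: l @N => k N.
    by exists (size P); split; rewrite ?leqnn // /N PoszD.
  exists (k.+1 + k.+1 + size P)%N; split; last by rewrite leq_addl.
  by rewrite /N NegzE !PoszD !addrA addNr add0r.
have [NE PM] := MlE.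
have coefE : ('X^N * u)`_M = laurent_of_poly u l.
  rewrite coefXnM /laurent_of_poly.
  have -> : (M < N)%N = ~~ (l <= 0).
    by rewrite -ltz_nat NE -subr_gt0 addrK ltNge.
  have [l0|//] /= := leP l 0; suff [->] : (M - N)%N%:Z = (absz l)%:Z by [].
  rewrite abszE ler0_norm // -subzn ?NE ?opprD.
    by rewrite addrCA subrr addr0.
  by rewrite -lez_nat NE gerDr.
transitivity (\sum_(i < size P) P`_i * (('X^N * u) %/ P)`_(M - i)).
  apply: eq_bigr => i _; congr (_ * _).
  have iM : (i <= M)%N by rewrite (leq_trans _ PM) // ltnW.
  rewrite (@laurent_frac_shift _ _ _ N) //; last by rewrite NE lerD2l lez_nat.
  have -> : N%:Z - (l + i%:Z) = (M - i)%N%:Z.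
    by rewrite NE opprD addrACA subrr add0r subzn.
  by rewrite absz_nat.
rewrite -coefE {2}(divp_eq ('X^N * u) P) coefD [X in _ + X]nth_default ?addr0; last first.
  by rewrite (leq_trans _ PM) // ltnW // ltn_modp.
rewrite [_ * P]mulrC coefM.
rewrite (big_ord_widen M.+1 (fun i => P`_i * (('X^N * u) %/ P)`_(M - i))) ?leqW //.
rewrite [RHS](bigID (fun i : 'I_M.+1 => (i < size P)%N)) /=.
rewrite [X in _ = _ + X]big1 ?addr0 // => i; rewrite -leqNgt => hi.
by rewrite nth_default ?mul0r.
Qed.

(* The digits t_l in 'F_b are read as the integers 0, ..., b-1. *)
Definition vtrunc (R : realType) (b m : nat) (t : int -> 'F_b) : R :=
  \sum_(1 <= l < m.+1) (t l%:Z : nat)%:R * b%:R ^- l.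

Definition digit_poly (b m n : nat) : {poly 'F_b} :=
  \poly_(i < m) ((n %/ b ^ i) %% b)%N%:R.

Definition poly_lattice_point (R : realType) (b m t : nat) (P : {poly 'F_b})
    (g : 'I_t -> {poly 'F_b}) (n : nat) : 'rV[R]_t :=
  \row_j vtrunc R m (laurent_frac (digit_poly b m n * g j) P).

(* i-th digit (i >= 1) of the b-adic expansion of x in [0,1) that does not end
   in infinitely many digits b-1. *)
Definition radix_digit (R : realType) (b : nat) (x : R) (i : nat) : nat :=
  (Num.truncn (x * b%:R ^+ i) %% b)%N.

(* Indices are shifted to start from 0. *)
Definition digit_interlace (R : realType) (b a : nat) (x : 'I_a -> R) : R :=
  limn (series (fun i => (\sum_(j < a)
    (radix_digit b (x j) i.+1)%:R * b%:R ^- (j.+1 + i * a)) : R)).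

Lemma block_index_subproof (s a : nat) (k : 'I_s) (j : 'I_a) :
  (k * a + j < a * s)%N.
Proof.
rewrite (@leq_trans (k.+1 * a)%N) //; first by rewrite mulSn addnC ltn_add2r.
by rewrite mulnC leq_mul2l ltn_ord orbT.
Qed.

Definition block_index (s a : nat) (k : 'I_s) (j : 'I_a) : 'I_(a * s) :=
  Ordinal (block_index_subproof k j).

Definition interlace_row (R : realType) (b a s : nat) (x : 'rV[R]_(a * s)) :
    'rV[R]_s :=
  \row_k digit_interlace b (fun j => x 0 (block_index k j)).

Definition interlaced_poly_lattice_rule (R : realType) (b a m s : nat)
    (x : 'I_(b ^ m) -> 'rV[R]_s) : Prop :=
  exists (P : {poly 'F_b}) (g : 'I_(a * s) -> {poly 'F_b}),
    [/\ irreducible_poly P, size P = m.+1,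
        forall j, (size (g j) <= m)%N &
        forall n, x n = interlace_row b (poly_lattice_point R m P g n)].

Definition tensor_rule (R : realType) (s1 s2 n1 n2 : nat)
    (x : 'I_n1 -> 'rV[R]_s1) (w : 'I_n2 -> 'rV[R]_s2)
    (F : 'rV[R]_s1 -> 'rV[R]_s2 -> R) : R :=
  (n1%:R * n2%:R)^-1 * \sum_(l < n2) \sum_(i < n1) F (x i) (w l).

(* [N1 j], [N2 j] are the numbers of points of the rules [x j], [w j]; only
   [j >= 1] matters. *)
Definition level_rule (R : realType) (s1 s2 : nat) (N1 N2 : nat -> nat)
    (x : forall j, 'I_(N1 j) -> 'rV[R]_s1)
    (w : forall j, 'I_(N2 j) -> 'rV[R]_s2)
    (j k : nat) (F : 'rV[R]_s1 -> 'rV[R]_s2 -> R) : R :=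
  if (j == 0)%N || (k == 0)%N then 0 else tensor_rule (x j) (w k) F.

Definition sparse_grid (R : realType) (s1 s2 : nat) (N1 N2 : nat -> nat)
    (x : forall j, 'I_(N1 j) -> 'rV[R]_s1)
    (w : forall j, 'I_(N2 j) -> 'rV[R]_s2)
    (L : nat) (F : 'rV[R]_s1 -> 'rV[R]_s2 -> R) : R :=
  \sum_(1 <= k < L)
    (level_rule x w (L - k) k F - level_rule x w (L - k) k.-1 F).

Definition sparse_grid_size (N1 N2 : nat -> nat) (L : nat) : nat :=
  (\sum_(1 <= k < L) N1 (L - k) * N2 k)%N.

(* Main.v *)
Require Import Defs.
From HB Require Import structures.
From mathcomp Require Import all_boot all_order all_algebra.
From mathcomp Require Import fingroup cyclic falgebra fieldext galois finfield.
From mathcomp Require Import all_classical all_reals all_analysis.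
From mathcomp Require Import measurable_realfun ring lra zify.

Set Implicit Arguments.
Unset Strict Implicit.
Unset Printing Implicit Defensive.

Import Order.TTheory GRing.Theory Num.Theory.
Import numFieldNormedType.Exports.

Local Open Scope classical_set_scope.
Local Open Scope ring_scope.

(* One variable block.  With n = m * alpha digits per coordinate, the points of
   the rule and a grid of mesh b^-n are both indexed by digit arrays over F_b,
   the rule by a linear image of F_b^m.  Expanding in the functions chr (k . x),
   where chr is 1 at 0 and -1/(b-1) elsewhere (a real substitute for the Walsh
   functions), the difference between the grid mean and the rule is a sum of
   coefficients over the nonzero k of the dual of the rule.  Since chr sums to
   zero, such a coefficient is an average of iterated differences of f at the
   positions of nonzero digits of k; using the alpha most significant digits of
   k in each coordinate and the mean value theorem, it is at most
   |nu|! prod_j prod_i chi_j b^-i, whose p-th powers have a sum bounded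
   independently of the dimension because p < 1 < alpha p.  A nonzero k lies in
   the dual for at most a fraction b^-m of the generating vectors, so some
   vector makes the sum over the dual of the p-th powers O(b^-m), and the sum
   itself O(b^(-m/p)).

   Sparse grid.  In the telescoped error, the term of index k is bounded by the
   error of the y-rule of level L-k as well as by that of the z-rules of levels
   k and k-1, i.e. by O(min(b^(-theta (L-k)), b^(-theta k))), so only separate
   regularity in y and z is used, and the sum over k is O(b^(-theta L/2)). *)

(** * Expansion over digit arrays *)

(** Joins the pointwise group structure to finiteness, so that digit arrays over ['F_b] can serve
    both as index sets of finite sums and as groups of translations. *)
HB.instance Definition _ (aT : finType) (rT : finZmodType) :=
  GRing.Zmodule.on {ffun aT -> rT}.

(** This is the average of the b - 1 nontrivial additive characters of F_b. It is real and has zero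
    sum, but it is not multiplicative. *)
Definition chr (R : realType) (b : nat) (t : 'F_b) : R :=
  if t == 0 then 1 else - (b.-1%:R)^-1.

Lemma sum_chr (R : realType) (b : nat) : prime b ->
  \sum_(t : 'F_b) chr R t = 0.
Proof.
move=> pb; have b1 := prime_gt1 pb.
rewrite (bigD1 0) //= /chr eqxx.
rewrite (eq_bigr (fun=> - (b.-1%:R)^-1)) => [|t /negPf -> //].
rewrite sumr_const cardC1 card_Fp // mulNrn -[_ *+ _]mulr_natl divff ?subrr //.
by rewrite pnatr_eq0; lia.
Qed.

Lemma normr_chr (R : realType) (b : nat) (t : 'F_b) :
  prime b -> `|chr R t| <= 1.
Proof.
move=> pb; have b1 := prime_gt1 pb; rewrite /chr.
case: eqP => _; rewrite ?normr1 // normrN ger0_norm ?invr_ge0 //.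
by rewrite invf_le1 ?ler1n ?ltr0n; lia.
Qed.

(** Translating by the multiples of v leaves the sum unchanged, while the argument of [chr] runs
    through all of F_b because d is nonzero. Adding the b translates gives b times the sum on one
    side and a multiple of the sum of [chr], namely 0, on the other. *)
Lemma sum_mul_chr_eq0 (R : realType) (b : nat) (V : finZmodType)
    (phi : V -> 'F_b) (Psi : V -> R) (v : V) (d : 'F_b) :
  prime b -> d != 0 -> (forall x, phi (x + v) = phi x + d) ->
  (forall x, Psi (x + v) = Psi x) -> \sum_x Psi x * chr R (phi x) = 0.
Proof.
move=> pb d0 phiD PsiD; set S := LHS.
have shift (a : 'F_b) : S = \sum_x Psi x * chr R (phi x + a * d).
  have phiDn n x : phi (x + v *+ n) = phi x + n%:R * d.
    elim: n x => [|n IHn] x; first by rewrite mulr0n addr0 mul0r addr0.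
    by rewrite mulrSr addrA phiD IHn -[n.+1]addn1 natrD mulrDl mul1r addrA.
  have PsiDn n x : Psi (x + v *+ n) = Psi x.
    elim: n x => [|n IHn] x; first by rewrite mulr0n addr0.
    by rewrite mulrSr addrA PsiD IHn.
  rewrite /S (reindex_inj (addIr (v *+ a))); apply: eq_bigr => x _.
  by rewrite PsiDn phiDn natr_Zp.
have : \sum_(a : 'F_b) S = 0.
  under eq_bigr => a _ do rewrite (shift a).
  rewrite exchange_big big1 // => x _; rewrite -mulr_sumr.
  have inj : injective (fun a : 'F_b => phi x + a * d).
    by move=> a a' /addrI /(mulIf d0).
  have -> : \sum_(a : 'F_b) chr R (phi x + a * d) = \sum_(a : 'F_b) chr R a.
    by rewrite [RHS](reindex_inj inj).
  by rewrite sum_chr ?mulr0.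
rewrite sumr_const card_Fp // => /eqP; rewrite mulrn_eq0.
by case/orP => [/eqP b0|/eqP //]; rewrite b0 in pb.
Qed.

Notation digits b s n := {ffun 'I_s -> {ffun 'I_n -> 'F_b}}.

Definition dot (b s n : nat) (k x : digits b s n) : 'F_b :=
  \sum_j \sum_i k j i * x j i.

Lemma dotDl (b s n : nat) (k l x : digits b s n) :
  dot (k + l) x = dot k x + dot l x.
Proof.
rewrite /dot -big_split; apply: eq_bigr => j _; rewrite -big_split.
by apply: eq_bigr => i _; rewrite !ffunE mulrDl.
Qed.

Lemma dotC (b s n : nat) (k x : digits b s n) : dot k x = dot x k.
Proof. by apply: eq_bigr => j _; apply: eq_bigr => i _; rewrite mulrC. Qed.

Lemma dotDr (b s n : nat) (k x y : digits b s n) :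
  dot k (x + y) = dot k x + dot k y.
Proof. by rewrite dotC dotDl !(dotC k). Qed.

Lemma dotBr (b s n : nat) (k x y : digits b s n) :
  dot k (x - y) = dot k x - dot k y.
Proof. by apply/eqP; rewrite eq_sym subr_eq -dotDr subrK. Qed.

Definition unit_digit (b s n : nat) (j : 'I_s) (i : 'I_n) : digits b s n :=
  [ffun j' => [ffun i' => ((j' == j) && (i' == i))%:R]].

Lemma dot_unit (b s n : nat) (k : digits b s n) j i :
  dot k (unit_digit b j i) = k j i.
Proof.
rewrite /dot (bigD1 j) //= [X in _ + X]big1 ?addr0; last first.
  move=> j' /negPf jj'; rewrite big1 // => i' _; rewrite !ffunE jj'.
  by rewrite mulr0.
rewrite (bigD1 i) //= [X in _ + X]big1 ?addr0; last first.
  by move=> i' /negPf ii'; rewrite !ffunE ii' andbF mulr0.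
by rewrite !ffunE !eqxx mulr1.
Qed.

Lemma digits_neq0 (b s n : nat) (k : digits b s n) :
  k != 0 -> exists j i, k j i != 0.
Proof.
move=> k0; apply: contrapT => nk; case/eqP: k0.
apply/ffunP => j; apply/ffunP => i; rewrite !ffunE.
by apply/eqP; apply: contrapT => /negP kji; apply: nk; exists j, i.
Qed.

Lemma sum_chr_dot (R : realType) (b s n : nat) (x : digits b s n) :
  prime b -> \sum_k chr R (dot k x) = if x == 0 then #|{: digits b s n}|%:R else 0.
Proof.
move=> pb; have [->|x0] := eqVneq x 0.
  rewrite (eq_bigr (fun=> 1)) => [|k _]; last first.
    rewrite /dot big1 => [|j _]; first by rewrite /chr eqxx.
    by rewrite big1 // => i _; rewrite !ffunE mulr0.
  by rewrite sumr_const.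
have [j [i xji]] := digits_neq0 x0.
under eq_bigr => k _ do rewrite -[chr _ _]mul1r.
apply: (@sum_mul_chr_eq0 _ _ _ _ (fun=> 1) (unit_digit b j i) (x j i)) => // k.
by rewrite dotDl [X in _ + X]dotC dot_unit.
Qed.

Definition walsh_coef (R : realType) (b s n : nat) (f : digits b s n -> R)
    (k : digits b s n) : R :=
  #|{: digits b s n}|%:R^-1 * \sum_x f x * chr R (dot k x).

Lemma card_digits_neq0 (R : realType) (b s n : nat) :
  (#|{: digits b s n}|%:R : R) != 0.
Proof.
rewrite pnatr_eq0 -lt0n; apply/card_gt0P; exists (0 : digits b s n).
by rewrite inE.
Qed.

(** Since [chr] is not multiplicative, the kernel [chr (dot k (x - y))] does not split into a factor
    in x and a factor in y. The sum over k still vanishes unless x = y. *)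
Lemma walsh_inversion (R : realType) (b s n : nat) (f : digits b s n -> R) y :
  prime b ->
  f y = #|{: digits b s n}|%:R^-1 *
    \sum_k \sum_x f x * chr R (dot k (x - y)).
Proof.
move=> pb; rewrite exchange_big /= (bigD1 y) //= [X in _ + X]big1 ?addr0.
  rewrite -mulr_sumr sum_chr_dot // subrr eqxx mulrCA mulVf ?mulr1 //.
  exact: card_digits_neq0.
by move=> x xy; rewrite -mulr_sumr sum_chr_dot // subr_eq0 (negPf xy) mulr0.
Qed.

Lemma walsh_coef0 (R : realType) (b s n : nat) (f : digits b s n -> R) :
  walsh_coef f 0 = #|{: digits b s n}|%:R^-1 * \sum_x f x.
Proof.
congr (_ * _); apply: eq_bigr => x _; rewrite /dot big1 => [|j _].
  by rewrite /chr eqxx mulr1.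
by rewrite big1 // => i _; rewrite !ffunE mul0r.
Qed.

(** If k annihilates the image of X, the translation by [X v] disappears from the kernel and a
    coefficient remains. Otherwise some v has [dot k (X v)] nonzero, and the mean over the group
    kills the term of k. *)
Lemma mean_walsh (R : realType) (b s n : nat) (V : finZmodType)
    (X : V -> digits b s n) (f : digits b s n -> R) :
  prime b -> (forall u v, X (u + v) = X u + X v) ->
  #|V|%:R^-1 * \sum_v f (X v) =
  \sum_(k | [forall v, dot k (X v) == 0]) walsh_coef f k.
Proof.
move=> pb XD.
have V0 : (#|V|%:R : R) != 0.
  by rewrite pnatr_eq0 -lt0n; apply/card_gt0P; exists 0; rewrite inE.
under eq_bigr => v _ do rewrite (walsh_inversion f (X v) pb).
rewrite -mulr_sumr exchange_big /= mulr_sumr mulr_sumr [RHS]big_mkcond /=.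
apply: eq_bigr => k _; case: ifPn => [/forallP kX|].
  under eq_bigr => v _.
    under eq_bigr => x _ do rewrite dotBr (eqP (kX v)) subr0.
    over.
  by rewrite sumr_const /walsh_coef mulrCA -[(\sum_x _) *+ _]mulr_natl mulKf.
rewrite negb_forall => /existsP [v kv].
rewrite exchange_big /= big1 ?mulr0 // => x _.
apply: (@sum_mul_chr_eq0 _ _ _ _ (fun=> f x) v (- dot k (X v))) => //.
  by rewrite oppr_eq0.
by move=> u; rewrite XD opprD addrA !dotBr.
Qed.

(** * Iterated differences of smooth functions *)

(** Derivative relative to A, written as an estimate: at an endpoint of an interval it is one-sided,
    and it passes directly to differences of functions. *)
Definition set_derivative (R : realType) (A : set R) (f : R -> R) (x d : R) :=
  forall e, 0 < e -> exists2 r, 0 < r & forall u, u != 0 -> `|u| < r ->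
    A (x + u) -> `|f (x + u) - f x - u * d| <= e * `|u|.

Lemma set_derivative_bound (R : realType) (h : R) (f d : R -> R) (K : R) :
  0 <= h ->
  (forall x, 0 <= x <= h -> set_derivative [set y | 0 <= y <= h] f x (d x)) ->
  (forall x, 0 <= x <= h -> `|d x| <= K) -> `|f h - f 0| <= h * K.
Proof.
move=> h0 fd dK.
have [x||c] := @MVT_segment R f d 0 h h0.
- rewrite in_itv /= => /andP[x0 xh].
  have xin : 0 <= x <= h by rewrite !ltW.
  suff cv : (fun u : R => u^-1 *: (f (u *: 1 + x) - f x)) @ 0^' --> d x.
    apply: DeriveDef; first by apply/cvg_ex; exists (d x).
    by apply: cvg_lim cv.
  apply/cvgrPdist_le => e e0; have [r r0 fr] := fd x xin e e0.
  near=> u; have u0 : u != 0 by near: u; exact: nbhs_dnbhs_neq.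
  have ur : `|u| < Num.min r (Num.min x (h - x)).
    by near: u; apply: dnbhs0_lt; rewrite !lt_min r0 x0 subr_gt0.
  move: ur; rewrite !lt_min => /and3P[ur ux uh].
  have -> : u *: 1 + x = x + u by rewrite /GRing.scale /= mulr1 addrC.
  have -> : d x - u^-1 *: (f (x + u) - f x) = - (u^-1 * (f (x + u) - f x - u * d x)).
    by rewrite /GRing.scale /= [in RHS]mulrBr mulKf // opprB.
  rewrite normrN normrM normfV ler_pdivrMl ?normr_gt0 // [_ * e]mulrC.
  by apply: fr => //=; move: ux uh; rewrite !ltr_norml; lra.
- apply/subspace_continuousP => x; rewrite /= in_itv /= => xin.
  (* The estimate with constant 1 gives |f y - f x| <= (1 + |d x|) |y - x| near x, hence continuity,
     endpoints included. *)
  apply/cvgrPdist_le => e e0; have [r r0 fr] := fd x xin 1 ltr01.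
  have k0 : 0 < 1 + `|d x| by have := normr_ge0 (d x); lra.
  rewrite near_withinE; near=> y; rewrite /= in_itv /= => yin.
  have [->|yx] := eqVneq y x; first by rewrite subrr normr0 ltW.
  have yr : `|x - y| < Num.min r (e / (1 + `|d x|)).
    by near: y; apply: cvgr_dist_lt => //; rewrite lt_min r0 divr_gt0.
  move: yr; rewrite lt_min ltr_pdivlMr // distrC => /andP[yr ye].
  have := fr (y - x); rewrite subr_eq0 yx yr addrC subrK mul1r.
  move=> /(_ isT isT yin) hf; rewrite distrC.
  have -> : f y - f x = (f y - f x - (y - x) * d x) + (y - x) * d x by ring.
  apply: le_trans (ler_normD _ _) _; rewrite normrM.
  by apply: le_trans (ltW ye); rewrite mulrDr mulr1 lerD2r.
- rewrite in_itv /= subr0 => cin ->; rewrite normrM (ger0_norm h0) mulrC.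
  by rewrite ler_wpM2l ?dK.
Unshelve. all: by end_near. Qed.

Lemma set_derivativeB (R : realType) (A : set R) (f g : R -> R) (x c d : R) :
  set_derivative A f x c -> set_derivative A g x d ->
  set_derivative A (fun y => f y - g y) x (c - d).
Proof.
move=> fc gd e e0; have e20 : 0 < e / 2 by lra.
have [r r0 fr] := fc _ e20; have [r' r'0 gr] := gd _ e20.
exists (Num.min r r') => [|u u0]; rewrite lt_min ?r0 // => /andP[ur ur'] Axu.
have -> : f (x + u) - g (x + u) - (f x - g x) - u * (c - d) =
  (f (x + u) - f x - u * c) - (g (x + u) - g x - u * d) by ring.
apply: le_trans (ler_normB _ _) _.
have := fr u u0 ur Axu; have := gr u u0 ur' Axu; lra.
Qed.

Lemma pderivable_estimate (R : realType) (s : nat) (j : 'I_s)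
    (f : 'rV[R]_s -> R) (y : 'rV[R]_s) :
  pderivable j f y -> forall e, 0 < e -> exists2 r, 0 < r &
  forall u, u != 0 -> `|u| < r -> cube (y + u *: delta_mx 0 j) ->
  `|f (y + u *: delta_mx 0 j) - f y - u * pderive j f y| <= e * `|u|.
Proof.
move=> fy e e0.
have /cvgrPdist_le /(_ e e0) :
  diff_quot j f y h @[h --> cube_steps j y] --> pderive j f y by exact: fy.
rewrite near_withinE => /nbhs_ballP [r /= r0 fr]; exists r => // u u0 ur cu.
have {fr} := fr u; rewrite /ball /= sub0r normrN => /(_ ur u0 cu).
rewrite /diff_quot -(ler_pM2l (_ : 0 < `|u|)) ?normr_gt0 // -normrM.
by rewrite mulrBr mulVKf // distrC [_ * e]mulrC.
Qed.

(** Backward differences are used because clearing a digit lowers a coordinate. *)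
Fixpoint nabla (R : realType) (s : nat) (l : seq ('I_s * R))
    (f : 'rV[R]_s -> R) (y : 'rV[R]_s) : R :=
  if l is (j, h) :: l' then
    nabla l' f y - nabla l' f (y - h *: delta_mx 0 j)
  else f y.

Lemma mi_ext (s : nat) (nu mu : multi_index s) : nu =1 mu -> nu = mu.
Proof. by rewrite /multi_index in nu mu * => h; apply/ffunP. Qed.

Definition mi_add_count (R : realType) (s : nat) (nu : multi_index s)
    (l : seq ('I_s * R)) : multi_index s :=
  [ffun j => (nu j + count (fun jh => jh.1 == j) l)%N].

Lemma cube_shift (R : realType) (s : nat) (j : 'I_s) (y : 'rV[R]_s) (h t : R) :
  cube y -> cube (y - h *: delta_mx 0 j) -> 0 <= t <= h ->
  cube (y - t *: delta_mx 0 j).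
Proof.
move=> cy ch th i; have := cy i; have := ch i; rewrite !mxE eqxx /=.
by case: (i == j); rewrite /= ?(mulr1, mulr0); lra.
Qed.

(** The lowest point at which [nabla l f y] evaluates f when the steps are nonnegative. If it and y
    lie in the cube, so do all the other evaluation points. *)
Definition low_corner (R : realType) (s : nat) (l : seq ('I_s * R))
    (y : 'rV[R]_s) : 'rV[R]_s :=
  y - \sum_(jh <- l) jh.2 *: delta_mx 0 jh.1.

Lemma low_corner_cons (R : realType) (s : nat) j (h : R) (l : seq ('I_s * R)) y :
  low_corner ((j, h) :: l) y = low_corner l (y - h *: delta_mx 0 j).
Proof. by rewrite /low_corner big_cons /= opprD addrA. Qed.

Lemma low_corner_le (R : realType) (s : nat) (l : seq ('I_s * R)) y i :
  all (fun jh => 0 <= jh.2) l -> low_corner l y 0 i <= y 0 i.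
Proof.
elim: l y => [|[j h] l IHl] y /=; first by rewrite /low_corner big_nil subr0.
move=> /andP[h0 l0]; rewrite low_corner_cons; apply: le_trans (IHl _ l0) _.
by rewrite !mxE gerBl mulr_ge0.
Qed.

Lemma cube_between (R : realType) (s : nat) (x y z : 'rV[R]_s) :
  cube x -> cube z -> (forall i, x 0 i <= y 0 i <= z 0 i) -> cube y.
Proof. by move=> cx cz xyz i; have := cx i; have := cz i; have := xyz i; lra. Qed.

(** Differencing commutes with differentiation, by induction on the list of steps. The minus sign
    comes from moving down along coordinate j. *)
Lemma set_derivative_nabla (R : realType) (s a : nat) (f : 'rV[R]_s -> R)
    (nu : multi_index s) (l : seq ('I_s * R)) (j : 'I_s) (h t : R)
    (y : 'rV[R]_s) :
  has_mixed_pderives a f -> (forall i, (nu i <= a)%N) -> (nu j < a)%N ->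
  all (fun jh => 0 <= jh.2) l -> 0 <= h -> 0 <= t <= h ->
  cube y -> cube (low_corner l (y - h *: delta_mx 0 j)) ->
  set_derivative [set u | 0 <= u <= h]
    (fun u => nabla l (mixed_pderive nu f) (y - u *: delta_mx 0 j)) t
    (- nabla l (mixed_pderive (mi_succ nu j) f) (y - t *: delta_mx 0 j)).
Proof.
move=> sf nua nuj; elim: l y => [|[i k] l IHl] y l0 h0 th cy cl /=.
  rewrite /low_corner big_nil subr0 in cl.
  move=> e e0; have ct := cube_shift cy cl th.
  have [dj pj] := sf nu j _ nua nuj ct.
  have [r r0 fr] := pderivable_estimate dj e0.
  exists r => // u u0 ur /= tu; have := fr (- u).
  rewrite oppr_eq0 normrN pj => /(_ u0 ur).
  have -> : y - t *: delta_mx 0 j + - u *: delta_mx 0 j =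
            y - (t + u) *: delta_mx 0 j by rewrite scaleNr scalerDl opprD addrA.
  by rewrite mulrN -mulNr; apply; exact: cube_shift tu.
move: l0 => /= /andP[k0 l0].
have sw u : y - u *: delta_mx 0 j - k *: delta_mx 0 i =
            y - k *: delta_mx 0 i - u *: delta_mx 0 j by rewrite addrAC.
rewrite low_corner_cons sw in cl.
have cyk : cube (y - k *: delta_mx 0 i).
  apply: (cube_between cl cy) => i'; rewrite (le_trans (low_corner_le _ _ l0)) //=.
    by rewrite !mxE gerBl mulr_ge0.
  by rewrite !mxE gerBl mulr_ge0.
rewrite opprD.
under [X in set_derivative _ X]eq_fun => u do rewrite sw.
rewrite sw; apply: (@set_derivativeB _ _
  (fun u => nabla l (mixed_pderive nu f) (y - u *: delta_mx 0 j))
  (fun u => nabla l (mixed_pderive nu f)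
    (y - k *: delta_mx 0 i - u *: delta_mx 0 j))); last exact: IHl.
apply: IHl => //; apply: (cube_between cl cy) => i'; apply/andP; split.
  rewrite /low_corner !mxE lerD2r lerD2r gerBl mulr_ge0 //.
by apply: le_trans (low_corner_le _ _ l0) _; rewrite !mxE gerBl mulr_ge0.
Qed.

(** By the mean value theorem a difference with step h in direction j costs a factor h and one more
    derivative in variable j. The induction is over all nu, where the derivatives already taken
    accumulate. *)
Lemma nabla_bound (R : realType) (s a : nat) (f : 'rV[R]_s -> R)
    (B : multi_index s -> R) (l : seq ('I_s * R)) (nu : multi_index s) (y : 'rV[R]_s) :
  has_mixed_pderives a f ->
  (forall (nu : multi_index s) z, cube z -> (forall j, (nu j <= a)%N) ->
     `|mixed_pderive nu f z| <= B nu) ->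
  all (fun jh => 0 <= jh.2) l -> cube y -> cube (low_corner l y) ->
  (forall j, (mi_add_count nu l j <= a)%N) ->
  `|nabla l (mixed_pderive nu f) y|
    <= (\prod_(jh <- l) jh.2) * B (mi_add_count nu l).
Proof.
move=> sf fB; elim: l nu y => [|[j h] l IHl] nu y /=.
  move=> _ cy _ nua; rewrite big_nil mul1r.
  have <- : nu = mi_add_count nu ([::] : seq ('I_s * R)).
    by apply: mi_ext => i; rewrite ffunE addn0.
  by apply: fB => // i; have := nua i; rewrite ffunE addn0.
move=> /andP[h0 l0] cy; rewrite low_corner_cons => cl nua.
have nuE : mi_add_count nu ((j, h) :: l) = mi_add_count (mi_succ nu j) l.
  by apply: mi_ext => i; rewrite !ffunE /= addnA eq_sym.
have lea i : (nu i <= a)%N by have := nua i; rewrite ffunE; lia.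
have ltja : (nu j < a)%N by have := nua j; rewrite ffunE /= eqxx; lia.
have chy : cube (y - h *: delta_mx 0 j).
  apply: (cube_between cl cy) => i; rewrite low_corner_le //=.
  by rewrite !mxE gerBl mulr_ge0.
have := @set_derivative_bound R h
  (fun u => nabla l (mixed_pderive nu f) (y - u *: delta_mx 0 j))
  (fun u => - nabla l (mixed_pderive (mi_succ nu j) f) (y - u *: delta_mx 0 j))
  ((\prod_(jh <- l) jh.2) * B (mi_add_count nu ((j, h) :: l))) h0.
rewrite scale0r subr0 distrC big_cons -mulrA; apply => [t th|t th].
  exact: (set_derivative_nabla sf).
rewrite normrN nuE; apply: IHl => //.
- exact: cube_shift th.
- apply: (cube_between cl cy) => i; apply/andP; split.
    rewrite /low_corner !mxE lerD2r lerD2l lerN2 ler_wpM2r //.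
    by case/andP: th.
  apply: le_trans (low_corner_le _ _ l0) _; rewrite !mxE gerBl mulr_ge0 //.
  by case/andP: th.
- by move=> i; have := nua i; rewrite nuE.
Qed.

Lemma mixed_pderive0 (R : realType) (s : nat) (nu : multi_index s)
    (f : 'rV[R]_s -> R) : (forall j, nu j = 0%N) -> mixed_pderive nu f = f.
Proof.
by move=> nu0; rewrite /mixed_pderive; elim: (enum _) => //= j l ->; rewrite nu0.
Qed.

(** The zero multi-index at the origin gives |f 0| <= c. *)
Lemma pderive_bound_ge0 (R : realType) (s a : nat) (f : 'rV[R]_s -> R) (c : R)
    (chi : nat -> R) :
  (forall (nu : multi_index s) z, cube z -> (forall j, (nu j <= a)%N) ->
     `|mixed_pderive nu f z| <= c * (mi_abs nu)`!%:R * mi_pow chi nu) -> 0 <= c.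
Proof.
move=> fB; have cz : cube (0 : 'rV[R]_s) by move=> j; rewrite mxE lexx ler01.
pose nu0 : multi_index s := [ffun=> 0%N].
have := fB nu0 0 cz (fun=> _); rewrite /mi_abs /mi_pow.
rewrite big1 => [|j _]; last by rewrite ffunE.
rewrite big1 => [|j _]; last by rewrite ffunE.
by rewrite !mulr1 => h; apply: le_trans (h _) => // j; rewrite ffunE.
Qed.

(** * Decay of the coefficients *)

Definition gridpt (R : realType) (b s n : nat) (x : digits b s n) : 'rV[R]_s :=
  \row_j \sum_(i < n) (x j i : nat)%:R * b%:R ^- i.+1.

Lemma ltn_Fp (b : nat) (t : 'F_b) : prime b -> (t < b)%N.
Proof. by move=> pb; have := ltn_ord t; rewrite [X in (_ < X)%N]Fp_cast. Qed.

Lemma sum_digits_le (R : realType) (b n : nat) (d : 'I_n -> nat) :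
  (1 < b)%N -> (forall i, (d i < b)%N) ->
  \sum_(i < n) (d i)%:R * b%:R ^- i.+1 <= 1 - b%:R ^- n :> R.
Proof.
move=> b1; have b0 : 0 < b%:R :> R by rewrite ltr0n; lia.
elim: n d => [|n IHn] d db; first by rewrite big_ord0 expr0 invr1 subrr.
rewrite big_ord_recr /=; apply: le_trans (lerD (IHn _ _) (lexx _)) _ => //.
have : (d ord_max)%:R <= b%:R - 1 :> R.
  by rewrite lerBrDr natr1 ler_nat db.
rewrite -(ler_pM2r (_ : 0 < b%:R ^- n.+1)) ?invr_gt0 ?exprn_gt0 //.
rewrite [in X in _ <= X -> _]mulrBl mul1r exprS [in X in _ <= X - _ -> _]invfM.
by rewrite mulVKf ?gt_eqF //; lra.
Qed.

Lemma cube_gridpt (R : realType) (b s n : nat) (x : digits b s n) :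
  prime b -> cube (gridpt R x).
Proof.
move=> pb j; rewrite mxE sumr_ge0 /=; last first.
  by move=> i _; rewrite mulr_ge0 // invr_ge0 exprn_ge0.
have b1 := prime_gt1 pb.
apply: le_trans (sum_digits_le _ b1 _) _ => [i|]; first exact: ltn_Fp.
by rewrite gerBl invr_ge0 exprn_ge0.
Qed.

Definition clear_digit (b s n : nat) (j : 'I_s) (i : 'I_n) (x : digits b s n) :
    digits b s n :=
  [ffun j' => [ffun i' => if (j' == j) && (i' == i) then 0 else x j' i']].

Lemma gridpt_clear (R : realType) (b s n : nat) (j : 'I_s) (i : 'I_n)
    (x : digits b s n) :
  gridpt R (clear_digit j i x) =
  gridpt R x - ((x j i : nat)%:R * b%:R ^- i.+1) *: delta_mx 0 j.
Proof.
apply/rowP => j'; rewrite !mxE /=; case: (eqVneq j' j) => [->|jj'] /=.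
  rewrite mulr1 [in RHS](bigD1 i) //= addrAC subrr add0r (bigD1 i) //=.
  rewrite !ffunE !eqxx mul0r add0r; apply: eq_bigr => i' /negPf ii'.
  by rewrite !ffunE ii' andbF.
rewrite mulr0 subr0; apply: eq_bigr => i' _.
by rewrite !ffunE (negPf jj').
Qed.

Fixpoint clear_diff (R : realType) (b s n : nat) (t : seq ('I_s * 'I_n))
    (Phi : digits b s n -> R) (x : digits b s n) : R :=
  if t is (j, i) :: t' then
    clear_diff t' Phi x - clear_diff t' Phi (clear_digit j i x)
  else Phi x.

(** A term in which digit (j, i) has been cleared does not depend on that digit, whereas [dot k x]
    does since [k j i] is nonzero. Such a term is therefore orthogonal to [chr (dot k x)]. *)
Lemma sum_clear_diff (R : realType) (b s n : nat) (t : seq ('I_s * 'I_n))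
    (Phi : digits b s n -> R) (k : digits b s n) :
  prime b -> all (fun ji => k ji.1 ji.2 != 0) t ->
  \sum_x clear_diff t Phi x * chr R (dot k x) = \sum_x Phi x * chr R (dot k x).
Proof.
move=> pb; elim: t => [//|[j i] t IHt] /= /andP[kji kt].
under eq_bigr => x _ do rewrite mulrBl.
rewrite sumrB IHt // [X in _ - X](_ : _ = 0) ?subr0 //.
apply: (@sum_mul_chr_eq0 _ _ _ (dot k)
  (fun x => clear_diff t Phi (clear_digit j i x)) (unit_digit b j i)
  (k j i)) => // x; first by rewrite dotDr dot_unit.
congr (clear_diff _ _ _); apply/ffunP => j'; apply/ffunP => i'.
by rewrite !ffunE; case: ifP => // ->; rewrite addr0.
Qed.

Definition digit_steps (R : realType) (b s n : nat) (t : seq ('I_s * 'I_n))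
    (x : digits b s n) : seq ('I_s * R) :=
  [seq (ji.1, (x ji.1 ji.2 : nat)%:R * b%:R ^- ji.2.+1) | ji <- t].

Lemma digit_steps_clear (R : realType) (b s n : nat) (t : seq ('I_s * 'I_n))
    (j : 'I_s) (i : 'I_n) (x : digits b s n) : (j, i) \notin t ->
  digit_steps R t x = digit_steps R t (clear_digit j i x).
Proof.
move=> jit; apply/eq_in_map => -[j' i'] /= j'i't.
rewrite !ffunE; case: ifP => // /andP[/eqP j'j /eqP i'i].
by rewrite -j'j -i'i j'i't in jit.
Qed.

(** The step sizes depend on x, but clearing one position does not alter the steps at the others.
    For distinct positions the digit differences are thus spatial differences with fixed steps. *)
Lemma clear_diff_nabla (R : realType) (b s n : nat) (t : seq ('I_s * 'I_n))
    (f : 'rV[R]_s -> R) (x : digits b s n) : uniq t ->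
  clear_diff t (f \o gridpt R (n := n)) x = nabla (digit_steps R t x) f (gridpt R x).
Proof.
elim: t x => [//|[j i] t IHt] x /= /andP[jit ut]; rewrite !IHt // gridpt_clear.
by rewrite -digit_steps_clear.
Qed.

(** The lowest corner is again a grid point, obtained by clearing all the digits listed in t. *)
Lemma cube_low_corner_steps (R : realType) (b s n : nat)
    (t : seq ('I_s * 'I_n)) (x : digits b s n) :
  prime b -> uniq t -> cube (low_corner (digit_steps R t x) (gridpt R x)).
Proof.
move=> pb; elim: t x => [|[j i] t IHt] x /= => [_|/andP[jit ut]].
  by rewrite /low_corner big_nil subr0; exact: cube_gridpt.
rewrite low_corner_cons -gridpt_clear.
suff -> : digit_steps R t x = digit_steps R t (clear_digit j i x) by exact: IHt.
exact: digit_steps_clear.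
Qed.

(** Any set of positions of nonzero digits of k may be differenced, as long as no coordinate is used
    more often than derivatives are available in it. *)
Lemma walsh_coef_bound (R : realType) (b s n a : nat) (f : 'rV[R]_s -> R)
    (B : multi_index s -> R) (t : seq ('I_s * 'I_n)) (k : digits b s n) :
  prime b -> has_mixed_pderives a f ->
  (forall (nu : multi_index s) z, cube z -> (forall j, (nu j <= a)%N) ->
     `|mixed_pderive nu f z| <= B nu) ->
  uniq t -> all (fun ji => k ji.1 ji.2 != 0) t ->
  (forall j, (count (fun ji => ji.1 == j) t <= a)%N) ->
  `|walsh_coef (f \o gridpt R (n := n)) k| <=
  (\prod_(ji <- t) b%:R ^- ji.2) * B [ffun j => count (fun ji => ji.1 == j) t].
Proof.
move=> pb sf fB ut kt ta; set K := (_ * B _).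
have X0 : 0 < #|{: digits b s n}|%:R :> R.
  by rewrite lt0r card_digits_neq0 ler0n.
rewrite /walsh_coef -(sum_clear_diff _ pb kt) normrM ger0_norm ?invr_ge0 ?(ltW X0) //.
rewrite ler_pdivrMl // mulr_natl -sumr_const.
apply: le_trans (ler_norm_sum _ _ _) _; apply: ler_sum => x _.
rewrite normrM; apply: le_trans (ler_piMr (normr_ge0 _) (normr_chr _ _ pb)) _.
rewrite clear_diff_nabla //.
pose nu0 : multi_index s := [ffun=> 0%N].
have f0 : mixed_pderive nu0 f = f by apply: mixed_pderive0 => j; rewrite ffunE.
have stE : mi_add_count nu0 (digit_steps R t x) =
    [ffun j => count (fun ji => ji.1 == j) t].
  by apply: mi_ext => j; rewrite !ffunE add0n count_map.
have steps0 : all (fun jh => 0 <= jh.2) (digit_steps R t x).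
  by rewrite all_map; apply/allP => ji _ /=; rewrite mulr_ge0 // invr_ge0 exprn_ge0.
have := nabla_bound (l := digit_steps R t x) (nu := nu0) sf fB steps0
  (cube_gridpt R x pb).
rewrite stE f0 => /(_ _ _) h; apply: le_trans (h _ _) _.
- exact: cube_low_corner_steps.
- by move=> j; rewrite ffunE.
have B0 : 0 <= B [ffun j => count (fun ji => ji.1 == j) t].
  apply: le_trans (fB _ _ (cube_gridpt R x pb) _) => // j.
  by rewrite ffunE.
rewrite /K ler_wpM2r // big_map /=; apply: ler_prod => ji _.
(* A digit is at most b, so a step of place value b^-(i+1) is at most b^-i. *)
rewrite mulr_ge0 ?invr_ge0 ?exprn_ge0 //= exprS invfM mulrA.
rewrite ler_piMl ?invr_ge0 ?exprn_ge0 // ler_pdivrMr ?mul1r ?ler_nat.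
  exact/ltnW/ltn_Fp.
by rewrite ltr0n prime_gt0.
Qed.

(** * Summability of the bounds *)

Lemma gt0_powRD (R : realType) (x r s : R) :
  0 < x -> x `^ (r + s) = x `^ r * x `^ s.
Proof. by move=> x0; rewrite powRD // (gt_eqF x0) implybT. Qed.

Lemma powR_lt1 (R : realType) (x r : R) : 1 < x -> r < 0 -> x `^ r < 1.
Proof.
move=> x1 r0; rewrite /powR gt_eqF ?(lt_trans ltr01) // expR_lt1.
by rewrite nmulr_rlt0 ?ln_gt0.
Qed.

Lemma powR_prod (R : realType) (I : Type) (l : seq I) (F : I -> R) (p : R) :
  (forall i, 0 <= F i) -> (\prod_(i <- l) F i) `^ p = \prod_(i <- l) F i `^ p.
Proof.
move=> F0; elim: l => [|i l IHl]; first by rewrite !big_nil powR1.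
by rewrite !big_cons powRM ?IHl //; apply: prodr_ge0.
Qed.

Lemma sum_powR_le_limn (R : realType) (chi : nat -> R) (p : R) (s : nat) :
  cvgn (series (fun j => chi j `^ p)) ->
  \sum_(j < s) chi j `^ p <= limn (series (fun j => chi j `^ p)).
Proof.
move=> cv; have := @nondecreasing_cvgn_le R (series (fun j => chi j `^ p)) _ cv s.
rewrite /series /= big_mkord; apply.
by apply: nondecreasing_series => i _ _; exact: powR_ge0.
Qed.

(** The list is reversed because the most significant digits of k pair with the finest digits of x,
    which give the smallest factors b^-i. *)
Definition top_digits (b n a : nat) (kappa : {ffun 'I_n -> 'F_b}) : seq 'I_n :=
  take a [seq i <- rev (enum 'I_n) | kappa i != 0].

Definition add_top_digit (b n : nat) (d : 'F_b) (kappa : {ffun 'I_n -> 'F_b}) :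
    {ffun 'I_n.+1 -> 'F_b} :=
  [ffun i => if unlift ord_max i is Some j then kappa j else d].

Lemma sum_add_top_digit (R : realType) (b n : nat)
    (F : {ffun 'I_n.+1 -> 'F_b} -> R) :
  \sum_kappa F kappa = \sum_(d : 'F_b) \sum_kappa F (add_top_digit d kappa).
Proof.
rewrite pair_big /=.
rewrite (reindex (fun dk : 'F_b * _ => add_top_digit dk.1 dk.2)) //=.
exists (fun kappa => (kappa ord_max, [ffun j => kappa (lift ord_max j)])).
  case=> d kappa _; congr pair; first by rewrite ffunE unlift_none.
  by apply/ffunP => j; rewrite !ffunE liftK.
move=> kappa _; apply/ffunP => i; rewrite ffunE /=.
by case: unliftP => [j|] -> //; rewrite ffunE.
Qed.

Lemma prod_top_digits0 (R : realType) (b n : nat) (w : nat -> R)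
    (kappa : {ffun 'I_n -> 'F_b}) :
  \prod_(i <- top_digits 0 kappa) w i = 1.
Proof. by rewrite /top_digits take0 big_nil. Qed.

Lemma prod_top_digitsS (R : realType) (b n u : nat) (w : nat -> R) (d : 'F_b)
    (kappa : {ffun 'I_n -> 'F_b}) :
  \prod_(i <- top_digits u.+1 (add_top_digit d kappa)) w i =
  if d == 0 then \prod_(i <- top_digits u.+1 kappa) w i
  else w n * \prod_(i <- top_digits u kappa) w i.
Proof.
have tE v : \prod_(i <- take v [seq i <- rev (map (widen_ord (leqnSn n)) (enum 'I_n))
    | add_top_digit d kappa i != 0]) w i = \prod_(i <- top_digits v kappa) w i.
  rewrite -map_rev filter_map -map_take big_map /top_digits.
  congr (\prod_(i <- take _ _) _); apply: eq_filter => i /=.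
  rewrite ffunE; have -> : widen_ord (leqnSn n) i = lift ord_max i.
    by apply: val_inj; rewrite /= /bump leqNgt ltn_ord.
  by rewrite liftK.
rewrite {1}/top_digits enum_ordSr rev_rcons /= {1}ffunE unlift_none.
by case: eqP => [_|_] /=; rewrite ?big_cons /= tE.
Qed.

(* Splitting off the most significant digit; once [u] nonzero digits have been
   found the remaining ones are free, and the factor b^(n (1 - u/a)) pays for
   them by moving a power i/a of b into the weight of each kept digit. *)
Lemma sum_prod_top_digits (R : realType) (b n u a : nat) (w : nat -> R) :
  prime b -> (u <= a)%N -> (0 < a)%N -> (forall i, 0 <= w i) ->
  \sum_(kappa : {ffun 'I_n -> 'F_b}) \prod_(i <- top_digits u kappa) w i <=
  b%:R `^ (n%:R * (1 - u%:R / a%:R)) *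
  \prod_(i < n) (1 + b%:R * w i * b%:R `^ (i%:R / a%:R)).
Proof.
move=> pb + a0 w0; have b1 : 1 <= b%:R :> R by rewrite ler1n prime_gt0.
have b0 : 0 < b%:R :> R by rewrite ltr0n prime_gt0.
have P1 m : 1 <= \prod_(i < m) (1 + b%:R * w i * b%:R `^ (i%:R / a%:R)) :> R.
  elim/big_ind: _ => // [x y x1 y1|i _]; first by rewrite -[1]mulr1 ler_pM.
  by rewrite lerDl !mulr_ge0 ?powR_ge0.
elim: n u => [|n IHn] u ua.
  rewrite mul0r powRr0 big_ord0 mulr1 (eq_bigr (fun=> 1)) => [|kappa _].
    by rewrite sumr_const card_ffun !card_ord expn0.
  by rewrite /top_digits (_ : rev _ = [::]) ?big_nil // enum_ord0.
(* With no digit left to record, every array has product 1, and their number b^(n+1) is exactly the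
   prefactor for u = 0. *)
case: u ua => [|u] ua.
  under eq_bigr => kappa _ do rewrite prod_top_digits0.
  rewrite sumr_const card_ffun card_Fp // card_ord mul0r subr0 mulr1.
  by rewrite natrX powR_mulrn ?(ltW b0) // ler_peMr ?P1 // exprn_ge0 // ltW.
rewrite sum_add_top_digit (bigD1 0) //=.
under eq_bigr => kappa _ do rewrite prod_top_digitsS eqxx.
under [X in _ + X]eq_bigr => d /negPf d0.
  under eq_bigr => kappa _ do rewrite prod_top_digitsS d0.
  rewrite -mulr_sumr; over.
rewrite sumr_const cardC1 card_Fp //.
set P := \prod_(i < n) _ in IHn *; rewrite big_ord_recr /= -/P.
set E := 1 - u.+1%:R / a%:R.
have E0 : 0 <= E by rewrite subr_ge0 ler_pdivrMr ?ltr0n // mul1r ler_nat.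
have h1 := IHn _ ua; have h2 := IHn _ (ltnW ua); rewrite -/P -/E in h1 h2.
(* Recording one digit fewer raises the exponent by n/a. This surplus is attached to the weight of
   digit n. *)
have uE : n%:R * (1 - u%:R / a%:R) = n%:R * E + n%:R / a%:R.
  by rewrite /E -natr1; field; rewrite pnatr_eq0; lia.
rewrite uE gt0_powRD // in h2.
apply: le_trans (_ : b%:R `^ (n%:R * E) * P *
    (1 + b%:R * w n * b%:R `^ (n%:R / a%:R)) <= _).
  rewrite [X in _ <= X]mulrDr mulr1 lerD // -[leLHS]mulr_natl.
  have -> : b%:R `^ (n%:R * E) * P * (b%:R * w n * b%:R `^ (n%:R / a%:R)) =
    b%:R * (w n * (b%:R `^ (n%:R * E) * b%:R `^ (n%:R / a%:R) * P)) by ring.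
  apply: ler_pM => //; first by rewrite mulr_ge0 // sumr_ge0 // => k _; rewrite prodr_ge0.
  - by rewrite ler_nat leq_pred.
  - by rewrite ler_wpM2l.
rewrite -!mulrA ler_wpM2r //.
  by rewrite mulr_ge0 ?(le_trans _ (P1 _)) // addr_ge0 // !mulr_ge0 ?powR_ge0.
by rewrite ler_powR // ler_wpM2r // ler_nat.
Qed.

Lemma sum_geometric_le (R : realType) (n : nat) (x : R) : 0 <= x < 1 ->
  \sum_(i < n) x ^+ i <= (1 - x)^-1.
Proof.
move=> /andP[x0 x1]; have x1' : 0 < 1 - x by rewrite subr_gt0.
rewrite -[leRHS]mul1r ler_pdivlMr // mulrC -opprB mulNr -subrX1 opprB.
by rewrite gerBl exprn_ge0.
Qed.

(** With u = a the prefactor of [sum_prod_top_digits] is 1. The remaining product is bounded by 1 +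
    x <= exp x, and the exponents form a geometric series of ratio [rho] = b^(1/a - p), which is
    below 1 since p a > 1. *)
Lemma sum_prod_top_digits_expR (R : realType) (b a : nat) (p : R) :
  prime b -> 0 < p -> 1 < p * a%:R ->
  exists2 T : R, 0 <= T & forall n y, 0 <= y ->
  \sum_(kappa : {ffun 'I_n -> 'F_b})
     \prod_(i <- top_digits a kappa) (y * (b%:R ^- i) `^ p) <= expR (y * T).
Proof.
move=> pb p0 pa; have b0 : 0 < b%:R :> R by rewrite ltr0n prime_gt0.
have a0 : (0 < a)%N by case: a pa => //; rewrite mulr0 ltr10.
pose rho : R := b%:R `^ (a%:R^-1 - p).
have rho1 : 0 <= rho < 1.
  rewrite powR_ge0 /=; apply: powR_lt1; first by rewrite ltr1n prime_gt1.
  by rewrite subr_lt0 -div1r ltr_pdivrMr ?ltr0n.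
exists (b%:R / (1 - rho)) => [|n y y0].
  by rewrite divr_ge0 ?ltW // subr_gt0; case/andP: rho1.
apply: le_trans (sum_prod_top_digits (w := fun i => y * (b%:R ^- i) `^ p)
  n pb (leqnn a) a0 _) _ => [i|]; first by rewrite mulr_ge0 ?powR_ge0.
rewrite divff ?pnatr_eq0 -?lt0n // subrr mulr0 powRr0 mul1r.
apply: le_trans (_ : expR (\sum_(i < n) b%:R * y * rho ^+ i) <= _).
  rewrite expR_sum; apply: ler_prod => i _; apply/andP; split.
    by rewrite addr_ge0 // !mulr_ge0 ?powR_ge0 // ltW.
  suff -> : b%:R * (y * (b%:R ^- i) `^ p) * b%:R `^ (i%:R / a%:R) =
            b%:R * y * rho ^+ i by exact: expR_ge1Dx.
  rewrite -!mulrA; congr (_ * (_ * _)).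
  rewrite /rho -powR_mulrn ?powR_ge0 // -powRrM -powR_invn ?(ltW b0) // -powRrM.
  by rewrite -gt0_powRD //; congr (_ `^ _); ring.
rewrite ler_expR -mulr_sumr [leRHS]mulrA [y * _]mulrC ler_wpM2l //.
  by rewrite mulr_ge0 ?(ltW b0).
exact: sum_geometric_le.
Qed.

(** From n! <= (n+1)^n the term is at most E (E (n+1)^(p-1))^n with E = exp tau. Since p < 1 the
    base tends to 0. *)
Lemma sum_fact_powR_bounded (R : realType) (p tau : R) : 0 < p < 1 ->
  exists A : R, forall N, \sum_(n < N)
    (n`!%:R `^ p * n.+1%:R ^- n * expR (n.+1%:R * tau)) <= A.
Proof.
move=> /andP[p0 p1]; set E := expR tau; have E0 : 0 < E := expR_gt0 _.
pose e n : R := E * n.+1%:R `^ (p - 1).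
have term n : n`!%:R `^ p * n.+1%:R ^- n * expR (n.+1%:R * tau) <= E * e n ^+ n.
  rewrite expRM_natl -/E exprS mulrCA ler_wpM2l ?(ltW E0) // exprMn [leRHS]mulrC.
  rewrite ler_wpM2r ?exprn_ge0 ?(ltW E0) //.
  rewrite gt0_powRD // exprMn powR_inv1 // exprVn ler_wpM2r ?invr_ge0 ?exprn_ge0 //.
  rewrite -powR_mulrn ?powR_ge0 // -powRrM mulrC powRrM powR_mulrn //.
  rewrite ge0_ler_powR ?nnegrE ?exprn_ge0 ?(ltW p0) // -natrX ler_nat.
  suff : forall m, (m <= n)%N -> (m`! <= n.+1 ^ m)%N by apply.
  elim=> // m IHm mn; rewrite factS expnS leq_mul ?ltnS ?(ltnW mn) //.
  exact/IHm/ltnW.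
(* From this index on, (n+1)^(1-p) >= 2E, that is, the base [e n] is at most 1/2. *)
pose n0 := (Num.truncn ((2 * E) `^ (1 - p)^-1)).+1.
have small n : (n0 <= n)%N -> e n <= 2^-1.
  move=> n0n; rewrite /e -opprB powRN ler_pdivrMr ?powR_gt0 ?ltr0n //.
  rewrite mulrC ler_pdivlMr // mulrC.
  have -> : 2 * E = ((2 * E) `^ (1 - p)^-1) `^ (1 - p).
    by rewrite -powRrM mulVf ?powRr1 ?mulr_ge0 ?(ltW E0) // gt_eqF // subr_gt0.
  rewrite ge0_ler_powR ?nnegrE ?powR_ge0 ?subr_ge0 ?(ltW p1) //.
  apply/ltW/(lt_le_trans (truncnS_gt _)); rewrite ler_nat.
  by apply: leq_trans n0n _.
have en n : 0 <= e n by rewrite mulr_ge0 ?powR_ge0 ?(ltW E0).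
have eE n : e n <= E.
  rewrite /e ler_piMr ?(ltW E0) // -[leRHS](powRr0 n.+1%:R) ler_powR ?ler1n //.
  by rewrite subr_le0 ltW.
(* Large enough that the bound A 2^-n also covers n < n0, where 2 [e n] <= 2E + 1. *)
pose A := E * (2 * E + 1) ^+ n0.
have A_ge : E <= A.
  by rewrite ler_peMr ?(ltW E0) // exprn_ege1 // lerDr mulr_ge0 ?(ltW E0).
exists (A * (1 - 2^-1)^-1) => N.
apply: le_trans (_ : \sum_(n < N) A * 2^-1 ^+ n <= _); last first.
  rewrite -mulr_sumr ler_wpM2l ?(le_trans (ltW E0)) // sum_geometric_le //.
  by rewrite invr_ge0 ler0n /= invf_lt1 // ltr1n.
apply: ler_sum => n _; apply: le_trans (term n) _.
have [n0n|nn0] := leqP n0 n.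
  apply: ler_pM; rewrite ?exprn_ge0 ?(ltW E0) //.
  by rewrite lerXn2r ?nnegrE ?invr_ge0 ?ler0n ?small.
rewrite exprVn ler_pdivlMr ?exprn_gt0 // -mulrA ler_wpM2l ?(ltW E0) // -exprMn.
apply: le_trans (_ : (2 * E + 1) ^+ n <= _).
  rewrite lerXn2r ?nnegrE ?mulr_ge0 ?en // ?addr_ge0 ?mulr_ge0 ?(ltW E0) //.
  by have := eE n; lra.
by rewrite ler_weXn2l ?(ltnW nn0) // lerDr mulr_ge0 ?(ltW E0).
Qed.

(** The bound of [walsh_coef_bound] for c = 1 when the chosen positions are the top digits of k in
    every coordinate. *)
Definition walsh_weight (R : realType) (b s n a : nat) (chi : nat -> R)
    (k : digits b s n) : R :=
  (\sum_j size (top_digits a (k j)))`!%:R *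
  \prod_(j < s) \prod_(i <- top_digits a (k j)) (chi j * b%:R ^- i).

Lemma walsh_weight_ge0 (R : realType) (b s n a : nat) (chi : nat -> R)
    (k : digits b s n) : (forall j, 0 < chi j) -> 0 <= walsh_weight a chi k.
Proof.
move=> chi0; rewrite mulr_ge0 // prodr_ge0 // => j _; rewrite prodr_ge0 // => i _.
by rewrite mulr_ge0 ?invr_ge0 ?exprn_ge0 // ltW.
Qed.

(* The factorial couples the coordinates; it is decoupled by
   (N!)^p <= sum_m (m!)^p (m+1)^-m (m+1)^N, whose terms factor over them. *)
Lemma sum_walsh_weight (R : realType) (b a : nat) (p : R) (chi : nat -> R) :
  prime b -> 0 < p < 1 -> 1 < p * a%:R -> (forall j, 0 < chi j) ->
  cvgn (series (fun j => chi j `^ p)) ->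
  exists S : R, forall s n,
    \sum_(k : digits b s n) walsh_weight a chi k `^ p <= S.
Proof.
move=> pb p01 pa chi0 chi_cv; have /andP[p0 p1] := p01.
have [T T0 hT] := @sum_prod_top_digits_expR R b a p pb p0 pa.
set X := limn (series (fun j => chi j `^ p)).
have X_ge s : \sum_(j < s) chi j `^ p <= X := sum_powR_le_limn s chi_cv.
have [A hA] := @sum_fact_powR_bounded R p (T * X) p01.
exists A => s n; set N := fun k : digits b s n => (\sum_j size (top_digits a (k j)))%N.
pose w (z : R) j i := z * (chi j `^ p * (b%:R ^- i) `^ p).
have weightE (k : digits b s n) : walsh_weight a chi k `^ p <=
    \sum_(m < (s * a).+1) m`!%:R `^ p * m.+1%:R ^- m *
      \prod_(j < s) \prod_(i <- top_digits a (k j)) w m.+1%:R j i.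
  have Nlt : (N k < (s * a).+1)%N.
    rewrite ltnS -[s in (s * a)%N]card_ord -sum_nat_const leq_sum // => j _.
    by rewrite size_take_min geq_minl.
  (* Only the term m = N k is kept. There (m+1)^-m cancels the factors m+1, one for each recorded
     digit. *)
  rewrite (bigD1 (Ordinal Nlt)) //= -[leLHS]addr0 lerD //; last first.
    rewrite sumr_ge0 // => m _; rewrite !mulr_ge0 ?powR_ge0 ?invr_ge0 ?exprn_ge0 //.
    rewrite prodr_ge0 // => j _; rewrite prodr_ge0 // => i _.
    by rewrite !mulr_ge0 ?powR_ge0.
  rewrite /walsh_weight powRM ?ler0n //; last first.
    rewrite prodr_ge0 // => j _; rewrite prodr_ge0 // => i _.
    by rewrite mulr_ge0 ?invr_ge0 ?exprn_ge0 // ltW.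
  rewrite -mulrA ler_wpM2l ?powR_ge0 // powR_prod => [|j]; last first.
    rewrite prodr_ge0 // => i _.
    by rewrite mulr_ge0 ?invr_ge0 ?exprn_ge0 // ltW.
  have -> : (N k).+1%:R ^- N k =
      \prod_(j < s) \prod_(i <- top_digits a (k j)) (N k).+1%:R^-1 :> R.
    rewrite -exprVn /N expr_sum; apply: eq_bigr => j _.
    by rewrite big_const_seq count_predT iter_mulr_1.
  rewrite -big_split /= ler_prod // => j _; apply/andP; split.
    exact: powR_ge0.
  rewrite powR_prod => [|i]; last by rewrite mulr_ge0 ?invr_ge0 ?exprn_ge0 // ltW.
  rewrite -big_split /= ler_prod // => i _; rewrite powR_ge0 /=.
  rewrite /w mulKf ?pnatr_eq0 // powRM ?invr_ge0 ?exprn_ge0 //.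
  exact: ltW.
apply: le_trans (ler_sum _ (fun k _ => weightE k)) _.
rewrite exchange_big /=; apply: le_trans (hA (s * a).+1); apply: ler_sum => m _.
rewrite -mulr_sumr ler_wpM2l //.
(* The sum over arrays of a product over coordinates is the product of the one-coordinate sums. Each
   is at most an exponential, and the exponents add up to at most (m+1) T X in every dimension. *)
rewrite -(bigA_distr_bigA (fun (j : 'I_s) (kappa : {ffun 'I_n -> 'F_b}) =>
  \prod_(i <- top_digits a kappa) w m.+1%:R j i)) /=.
apply: le_trans (_ : \prod_(j < s) expR (m.+1%:R * chi j `^ p * T) <= _).
  apply: ler_prod => j _; apply/andP; split.
    rewrite sumr_ge0 // => kappa _; rewrite prodr_ge0 // => i _.
    by rewrite !mulr_ge0 ?powR_ge0.
  under eq_bigr => kappa _ do under eq_bigr => i _ do rewrite /w mulrA.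
  by apply: hT; rewrite mulr_ge0 ?powR_ge0.
rewrite -expR_sum ler_expR -mulr_suml -mulr_sumr -mulrA ler_wpM2l //.
by rewrite mulrC ler_wpM2l.
Qed.

(** Keeping at most a digits per coordinate keeps the order of differentiation in each variable
    within the regularity of f. *)
Lemma walsh_coef_weight (R : realType) (b s n a : nat) (f : 'rV[R]_s -> R)
    (c : R) (chi : nat -> R) (k : digits b s n) :
  prime b -> has_mixed_pderives a f ->
  (forall (nu : multi_index s) z, cube z -> (forall j, (nu j <= a)%N) ->
     `|mixed_pderive nu f z| <= c * (mi_abs nu)`!%:R * mi_pow chi nu) ->
  `|walsh_coef (f \o gridpt R (n := n)) k| <= c * walsh_weight a chi k.
Proof.
move=> pb sf fB.
pose t := [seq (j, i) | j <- enum 'I_s, i <- top_digits a (k j)].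
have count_t j : count (fun ji => ji.1 == j) t = size (top_digits a (k j)).
  rewrite /t count_flatten -map_comp sumnE big_map big_enum /= (bigD1 j) //=.
  rewrite count_map big1 ?addn0 => [|j' /negPf j'j].
    by rewrite (eq_count (a2 := predT)) ?count_predT // => i /=; rewrite eqxx.
  rewrite count_map (eq_count (a2 := pred0)) ?count_pred0 // => i /=.
have top_le j : (size (top_digits a (k j)) <= a)%N.
  by rewrite size_take_min geq_minl.
have := @walsh_coef_bound R b s n a f _ t k pb sf fB.
have -> : [ffun j => count (fun ji => ji.1 == j) t] =
    [ffun j => size (top_digits a (k j))] :> multi_index s.
  by apply: mi_ext => j; rewrite !ffunE count_t.
move=> H; apply: le_trans (H _ _ _) _.
- apply: allpairs_uniq_dep; first exact: enum_uniq.
    by move=> j _; rewrite take_uniq // filter_uniq // rev_uniq enum_uniq.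
  by move=> [j i] [j' i'] _ _ /= [-> ->].
- apply/allP => -[j i] /allpairsPdep [j' [i' [_ /mem_take]]].
  by rewrite mem_filter => /andP[ki _] [-> ->].
- by move=> j; rewrite count_t.
rewrite /walsh_weight.
have -> : mi_abs ([ffun j => size (top_digits a (k j))] : multi_index s) =
    (\sum_j size (top_digits a (k j)))%N.
  by apply: eq_bigr => j _; rewrite ffunE.
have -> : \prod_(j < s) \prod_(i <- top_digits a (k j)) (chi j * b%:R ^- i) =
    mi_pow chi ([ffun j => size (top_digits a (k j))] : multi_index s) *
    \prod_(ji <- t) b%:R ^- ji.2.
  rewrite /mi_pow big_allpairs_dep big_enum /= -big_split /=.
  apply: eq_bigr => j _; rewrite big_split /= ffunE; congr (_ * _).
  by rewrite big_const_seq count_predT iter_mulr_1.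
by rewrite mulrC !mulrA.
Qed.

(** * Interlaced polynomial lattice rules and their duals *)

(** Take the minimal polynomial over F_b of a generator of the multiplicative group of the field
    with b^m elements. The generator spans the whole field, so the degree is m. *)
Lemma exists_irreducible_poly (b m : nat) : prime b -> (0 < m)%N ->
  exists P : {poly 'F_b}, irreducible_poly P /\ size P = m.+1.
Proof.
move=> pb m0; have [K charK cardK] := pPrimePowerField pb m0.
pose L : splittingFieldType 'F_b := pPrimeCharType charK.
have /cyclicP [u uE] := field_unit_group_cyclic [set: {unit K}]%G.
pose z : L := FinRing.uval u.
have zfull : (<<1; z>> = fullv)%VS.
  apply/vspaceP => x; rewrite memvf; have [->|x0] := eqVneq x 0; first exact: mem0v.
  have xu : (x : K) \is a GRing.unit by rewrite unitfE.
  have : FinRing.unit K xu \in <[u]>%g by rewrite -uE inE.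
  case/cycleP => i /(congr1 val) /= ->; rewrite FinRing.val_unitX.
  exact: (@rpredX _ <<1; z>>%AS i z (memv_adjoin _ _)).
have dimL : \dim {:L} = m.
  have := pprimeChar_dimf charK.
  rewrite cardK pfactorK //.
have /polyOver1P [Q Qdef] := minPolyOver 1%AS z.
have sQ : size Q = m.+1.
  rewrite -(size_map_poly (in_alg L)) -Qdef size_minPoly; congr S.
  by rewrite adjoin_degreeE zfull dimv1 divn1.
exists Q; split => //; split; first by rewrite sQ ltnS.
move=> d d1 dQ.
have dmin : map_poly (in_alg L) d %| minPoly 1%AS z by rewrite Qdef dvdp_map.
have := minPoly_irr (alg_polyOver _ _) dmin.
by rewrite Qdef eqp_map -size_poly_eq1 size_map_poly (negPf d1) orbF.
Qed.

(** Encodes polynomials of degree below m by coefficient arrays, so that generating vectors form a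
    finite group over which one can average. *)
Definition ffpoly (b m : nat) (v : {ffun 'I_m -> 'F_b}) : {poly 'F_b} :=
  \sum_(i < m) v i *: 'X^i.

Lemma ffpolyD (b m : nat) (u v : {ffun 'I_m -> 'F_b}) :
  ffpoly (u + v) = ffpoly u + ffpoly v.
Proof.
by rewrite -big_split; apply: eq_bigr => i _; rewrite ffunE scalerDl.
Qed.

Lemma ffpoly0 (b m : nat) : ffpoly (0 : {ffun 'I_m -> 'F_b}) = 0.
Proof. by rewrite /ffpoly big1 // => i _; rewrite ffunE scale0r. Qed.

Lemma coef_ffpoly (b m : nat) (v : {ffun 'I_m -> 'F_b}) (i : 'I_m) :
  (ffpoly v)`_i = v i.
Proof.
rewrite coef_sum (bigD1 i) //= coefZ coefXn eqxx mulr1 big1 ?addr0 // => j ji.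
by rewrite coefZ coefXn -val_eqE eq_sym in ji *; rewrite (negPf ji) mulr0.
Qed.

Lemma size_ffpoly (b m : nat) (v : {ffun 'I_m -> 'F_b}) : (size (ffpoly v) <= m)%N.
Proof.
apply: leq_trans (size_sum _ _ _) _; apply/bigmax_leqP => i _.
by rewrite (leq_trans (size_scale_leq _ _)) // size_polyXn.
Qed.

Lemma ffpoly_coef (b m : nat) (u : {poly 'F_b}) : (size u <= m)%N ->
  ffpoly [ffun i : 'I_m => u`_i] = u.
Proof.
move=> um; apply/polyP => i; have [im|mi] := ltnP i m.
  by rewrite (coef_ffpoly _ (Ordinal im)) ffunE.
by rewrite !nth_default // (leq_trans _ mi) // size_ffpoly.
Qed.

Lemma ffpoly_eq0 (b m : nat) (v : {ffun 'I_m -> 'F_b}) :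
  ffpoly v = 0 -> v = 0.
Proof.
by move=> v0; apply/ffunP => i; rewrite -coef_ffpoly v0 coef0 ffunE.
Qed.

Lemma laurent_fracD (K : fieldType) (u v P : {poly K}) (l : nat) :
  laurent_frac (u + v) P l = laurent_frac u P l + laurent_frac v P l.
Proof. by rewrite /= mulrDr divpD coefD. Qed.

Lemma laurent_frac0 (K : fieldType) (P : {poly K}) (l : nat) :
  laurent_frac 0 P l = 0.
Proof. by rewrite /= mulr0 div0p coef0. Qed.

Lemma laurent_frac_modp (K : fieldType) (u P : {poly K}) (l : nat) :
  P != 0 -> (0 < l)%N -> laurent_frac (u %% P) P l = laurent_frac u P l.
Proof.
move=> P0 l0; rewrite [in RHS](divp_eq u P) laurent_fracD /= mulrA mulpK //.
by rewrite coefXnM l0 add0r.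
Qed.

(** Provides a series whose first nonzero digit sits at a prescribed place: before place i+1 the
    dividend has degree below m, and at that place the quotient of x^m by P is the inverse of the
    leading coefficient. *)
Lemma laurent_frac_Xn (K : fieldType) (P : {poly K}) (m i l : nat) :
  size P = m.+1 -> (i < m)%N -> (l <= i.+1)%N ->
  laurent_frac 'X^(m - i.+1) P l =
  if l == i.+1 then (lead_coef P)^-1 else 0.
Proof.
move=> sP im li /=; rewrite -exprD.
have P0 : P != 0 by rewrite -size_poly_eq0 sP.
case: eqP => [->|/eqP lni]; last first.
  rewrite divp_small ?coef0 // size_polyXn sP; lia.
rewrite subnKC //.
have : size ('X^m %/ P) = 1%N by rewrite size_divp // size_polyXn sP subSnn.
move=> /eqP/size_poly1P [q q0 qE]; rewrite qE coefC eqxx.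
have /(congr1 lead_coef) := divp_eq 'X^m P.
have lt_mod : (size ('X^m %% P)%R < size (q *: P))%N.
  by rewrite size_scale // ltn_modp.
rewrite qE mul_polyC lead_coefXn lead_coefDl // lead_coefZ => /esym E.
have lP0 : lead_coef P != 0 by rewrite lead_coef_eq0.
by apply: (mulIf lP0); rewrite E mulVf.
Qed.

(** Interlacing only permutes digits, so the digit array of a point of the rule is additive both in
    v and in g. The factor is written [a.+1] so that [inord] has a nonempty target. *)
Definition interlaced_digits (b a s m : nat) (P : {poly 'F_b})
    (g : digits b (a.+1 * s) m) (v : {ffun 'I_m -> 'F_b}) :
    digits b s (m * a.+1) :=
  [ffun k : 'I_s => [ffun i : 'I_(m * a.+1) => laurent_frac
     (ffpoly v * ffpoly (g (block_index k (inord (i %% a.+1))))) P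
     (i %/ a.+1).+1%:Z]].

Lemma interlaced_digitsDr (b a s m : nat) (P : {poly 'F_b})
    (g : digits b (a.+1 * s) m) (u v : {ffun 'I_m -> 'F_b}) :
  interlaced_digits P g (u + v) =
  interlaced_digits P g u + interlaced_digits P g v.
Proof.
apply/ffunP => k; apply/ffunP => i.
by rewrite !ffunE ffpolyD mulrDl laurent_fracD.
Qed.

Lemma interlaced_digitsDl (b a s m : nat) (P : {poly 'F_b})
    (g h : digits b (a.+1 * s) m) (v : {ffun 'I_m -> 'F_b}) :
  interlaced_digits P (g + h) v =
  interlaced_digits P g v + interlaced_digits P h v.
Proof.
apply/ffunP => k; apply/ffunP => i.
by rewrite !ffunE ffpolyD mulrDr laurent_fracD.
Qed.

Lemma block_index_inj (s a : nat) (k k' : 'I_s) (j j' : 'I_a) :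
  block_index k j = block_index k' j' -> k = k' /\ j = j'.
Proof.
move=> /(congr1 val) /= E; have a0 : (0 < a)%N by case: a j {j' E} => [[]|].
split; apply: val_inj.
  have := congr1 (divn^~ a) E; rewrite /= !divnMDl //.
  by rewrite !divn_small ?addn0.
by have := congr1 (modn^~ a) E; rewrite /= !modnMDl !modn_small.
Qed.

Definition single_generator (b t m : nat) (j : 'I_t) (h : {ffun 'I_m -> 'F_b}) :
    digits b t m := [ffun i => if i == j then h else 0].

(** A generator placed in a single component reaches only one residue class of digit positions in
    one coordinate. Choosing v so that the product with h is a suitable power of x modulo P isolates
    one nonzero digit of k in that class. *)
Lemma single_generator_separates (b a s m : nat) (P : {poly 'F_b})
    (k : digits b s (m * a.+1)) : irreducible_poly P -> size P = m.+1 -> k != 0 ->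
  exists j : 'I_(a.+1 * s), forall h, h != 0 ->
  exists v, dot k (interlaced_digits P (single_generator j h) v) != 0.
Proof.
move=> irrP sP /digits_neq0 [k0 [i0 ki0]].
have P0 : P != 0 by rewrite -size_poly_eq0 sP.
pose r : 'I_a.+1 := inord (i0 %% a.+1).
pose Q (i : 'I_(m * a.+1)) := (k k0 i != 0) && (i %% a.+1 == i0 %% a.+1)%N.
have Qi0 : Q i0 by rewrite /Q ki0 eqxx.
(* Among the nonzero digits of k in the residue class of i0, take the one at the furthest place. The
   others lie at earlier places, where the series constructed below vanishes. *)
case: (arg_maxnP (fun i : 'I_(m * a.+1) => i %/ a.+1)%N Qi0) => i1 /andP[ki1 i1r] i1max.
exists (block_index k0 r) => h h0.
pose q := (i1 %/ a.+1)%N.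
have qm : (q < m)%N by rewrite /q ltn_divLR.
have hP : coprimep P (ffpoly h).
  rewrite irreducible_poly_coprime //; apply/negP => /dvdp_leq.
  rewrite sP ltnNge size_ffpoly => /(_ _)/negP; apply => //.
  by apply: contra_neq h0; exact: ffpoly_eq0.
have [[u w] /= uw] := Bezout_eq1_coprimepP _ _ hP.
(* Since w inverts h modulo P, the product of v0 and h is congruent to x^(m-q-1), whose quotient by
   P starts at place q+1. *)
pose v0 := ('X^(m - q.+1) * w) %% P.
have v0m : (size v0 <= m)%N by rewrite -ltnS -sP ltn_modp.
exists [ffun i : 'I_m => v0`_i].
rewrite /dot (bigD1 k0) //= [X in _ + X]big1 ?addr0; last first.
  move=> k' k'k0; rewrite big1 // => i _; rewrite !ffunE.
  case: eqP => [/block_index_inj [/eqP]|_]; first by rewrite (negPf k'k0).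
  by rewrite ffpoly0 mulr0 laurent_frac0 mulr0.
have digE (i : 'I_(m * a.+1)) : (i %% a.+1 = i0 %% a.+1)%N ->
  interlaced_digits P (single_generator (block_index k0 r) h)
    [ffun i : 'I_m => v0`_i] k0 i = laurent_frac 'X^(m - q.+1) P (i %/ a.+1)%N.+1.
  move=> ir; rewrite !ffunE ir eqxx ffpoly_coef //.
  rewrite -laurent_frac_modp // mulrC modp_mul -[RHS]laurent_frac_modp //.
  congr (laurent_frac _ _ _); rewrite -[in RHS](mulr1 'X^_) -uw mulrDr modpD.
  by rewrite [in RHS](mulrA _ u) modp_mull add0r mulrC mulrA.
rewrite (bigD1 i1) //= digE ?(eqP i1r) // (laurent_frac_Xn sP) // eqxx.
rewrite big1 ?addr0; last first.
  move=> i ii1; have [Qi|] := boolP (Q i); last first.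
    rewrite negb_and negbK => /orP[/eqP->|ir]; first by rewrite mul0r.
    rewrite !ffunE; case: eqP => [/block_index_inj [_]|_].
      move/(congr1 val); rewrite /r /= !inordK ?ltn_pmod // => /eqP.
      by rewrite (negPf ir).
    by rewrite ffpoly0 mulr0 laurent_frac0 mulr0.
  have li : ((i %/ a.+1)%N.+1 <= q.+1)%N by rewrite ltnS; exact: i1max.
  have /andP[ki /eqP ir] := Qi; rewrite digE // (laurent_frac_Xn sP qm li).
  case: eqP => [[iq]|_]; last by rewrite mulr0.
  case/eqP: ii1; apply: val_inj.
  by rewrite /= (divn_eq i a.+1) (divn_eq i1 a.+1) iq -/q ir (eqP i1r).
by rewrite mulf_neq0 // invr_neq0 // lead_coef_eq0.
Qed.

(** The dual net of the rule generated by g, truncated to the digits in use. *)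
Definition in_dual (b a s m : nat) (P : {poly 'F_b})
    (g : digits b (a.+1 * s) m) (k : digits b s (m * a.+1)) : bool :=
  [forall v, dot k (interlaced_digits P g v) == 0].

(* The vectors whose dual contains [k] are disjoint from their translates by the
   b^m - 1 nonzero single generators at a suitable index. *)
Lemma card_in_dual (b a s m : nat) (P : {poly 'F_b})
    (k : digits b s (m * a.+1)) :
  prime b -> irreducible_poly P -> size P = m.+1 -> k != 0 ->
  (b ^ m * #|[set g : digits b (a.+1 * s) m | in_dual P g k]%SET|
     <= #|{: digits b (a.+1 * s) m}|)%N.
Proof.
move=> pb irrP sP k0.
have [j sep] := single_generator_separates irrP sP k0.
have cardV : #|[set: {ffun 'I_m -> 'F_b}]%SET| = (b ^ m)%N.
  by rewrite cardsT card_ffun card_Fp // card_ord.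
rewrite -cardV -cardsX.
pose shift (hg : {ffun 'I_m -> 'F_b} * digits b (a.+1 * s) m) :=
  hg.2 + single_generator j hg.1.
have singleB h h' : single_generator j (h - h') =
    single_generator j h - single_generator j h' :> digits b (a.+1 * s) m.
  by apply/ffunP => i; rewrite !ffunE; case: eqP => // _; rewrite subr0.
rewrite -(card_in_imset (f := shift)) ?max_card // => -[h g] [h' g'].
rewrite !inE /= => /forallP gk /forallP g'k; rewrite /shift /= => E.
have hh' : h = h'.
  (* If h and h' differed, the single generator h - h' would equal g' - g, whose digit arrays are
     all annihilated by k. *)
  apply/eqP; rewrite -subr_eq0; apply: contraT => /sep [v].
  have -> : single_generator j (h - h') = g' - g.
    by rewrite singleB; apply/eqP; rewrite subr_eq addrAC -E addrAC subrr add0r.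
  have -> : interlaced_digits P (g' - g) v =
      interlaced_digits P g' v - interlaced_digits P g v.
    by apply/eqP; rewrite eq_sym subr_eq -interlaced_digitsDl subrK.
  by rewrite dotBr (eqP (gk v)) (eqP (g'k v)) subrr eqxx.
by move: E; rewrite hh' => /addIr ->.
Qed.

(** Averaging over generating vectors: by [card_in_dual] each nonzero k contributes to at most a
    fraction b^-m of the dual sums, so they cannot all exceed b^-m S. *)
Lemma exists_small_dual_sum (R : realType) (b a s m : nat) (P : {poly 'F_b})
    (W : digits b s (m * a.+1) -> R) (S : R) :
  prime b -> irreducible_poly P -> size P = m.+1 -> (forall k, 0 <= W k) ->
  \sum_k W k <= S ->
  exists g : digits b (a.+1 * s) m,
    \sum_(k | (k != 0) && in_dual P g k) W k <= b%:R ^- m * S.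
Proof.
move=> pb irrP sP W0 WS; apply: contrapT => /forallNP none.
have bm0 : 0 < (b ^ m)%N%:R :> R by rewrite ltr0n expn_gt0 prime_gt0.
set G := digits b (a.+1 * s) m.
have G0 : 0 < #|{: G}|%:R :> R by rewrite lt0r card_digits_neq0 ler0n.
have : \sum_(g : G) b%:R ^- m * S < \sum_(g : G)
    \sum_(k | (k != 0) && in_dual P g k) W k.
  apply: ltr_sum => [|g _]; first by apply/hasP; exists 0; rewrite ?mem_index_enum.
  by rewrite ltNge; apply/negP/none.
rewrite sumr_const (exchange_big_dep (fun k => k != 0)) /= => [|g k _ /andP[]//].
apply/negP; rewrite -leNgt.
apply: le_trans (_ : \sum_(k | k != 0) (b%:R ^- m * #|{: G}|%:R) * W k <= _).
  apply: ler_sum => k k0; rewrite sumr_const -[leLHS]mulr_natl ler_wpM2r //.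
  rewrite mulrC ler_pdivlMr -?natrX // -natrM ler_nat mulnC.
  apply: leq_trans (card_in_dual pb irrP sP k0); rewrite leq_mul2l; apply/orP; right.
  by apply: eq_leq; apply: eq_card => g; rewrite !inE k0.
rewrite -mulr_sumr -[leRHS]mulr_natl mulrA [_%:R * _]mulrC ler_wpM2l //.
apply: le_trans WS; rewrite [leRHS](bigID (fun k => k != 0)) /= lerDl.
by rewrite sumr_ge0.
Qed.

Lemma sum_base_digits (b n d : nat) : (0 < b)%N -> (d < b ^ n)%N ->
  (\sum_(i < n) (d %/ b ^ i) %% b * b ^ i = d)%N.
Proof.
move=> b0; elim: n d => [|n IHn] d.
  by rewrite expn0 ltnS leqn0 => /eqP ->; rewrite big_ord0.
rewrite expnS => db; rewrite big_ord_recl expn0 divn1 muln1.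
rewrite [RHS](divn_eq d b) addnC; congr (_ + _)%N.
rewrite -[in RHS](IHn (d %/ b)%N) ?ltn_divLR ?[(_ ^ n * _)%N]mulnC // big_distrl.
by apply: eq_bigr => i _; rewrite /= /bump /= add1n -divnMA -expnS -mulnA -expnSr.
Qed.

Definition base_digits (b m n : nat) : {ffun 'I_m -> 'F_b} :=
  [ffun i : 'I_m => ((n %/ b ^ i) %% b)%N%:R].

Lemma base_digits_bij (b m : nat) : prime b ->
  bijective (fun n : 'I_(b ^ m) => base_digits b m n).
Proof.
move=> pb; apply: inj_card_bij.
  move=> n n' /ffunP nn'; apply: val_inj.
  rewrite /= -(@sum_base_digits b m n) ?prime_gt0 //.
  rewrite -(@sum_base_digits b m n') ?prime_gt0 //.
  apply: eq_bigr => i _; have := nn' i; rewrite !ffunE.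
  by move=> /(congr1 val) /=; rewrite !val_Fp_nat // !modn_mod => ->.
by rewrite card_ffun card_Fp // !card_ord.
Qed.

Lemma digit_poly_ffpoly (b m n : nat) : digit_poly b m n = ffpoly (base_digits b m n).
Proof.
by rewrite /digit_poly poly_def; apply: eq_bigr => i _; rewrite ffunE.
Qed.

(** Multiplication by b moves the first digit into the integer part, and the tail stays in [0, 1),
    so no carry occurs. Induction on the number of digits does the rest. *)
Lemma radix_digit_sum (R : realType) (b m : nat) (t : nat -> nat) (i : nat) :
  (1 < b)%N -> (forall l, t l < b)%N ->
  radix_digit b (\sum_(l < m) (t l)%:R * b%:R ^- l.+1 : R) i.+1 =
  if (i < m)%N then t i else 0%N.
Proof.
move=> b1 + ; have b0 : b%:R != 0 :> R by rewrite pnatr_eq0; lia.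
elim: m i t => [|m IHm] i t tb.
  by rewrite big_ord0 /radix_digit mul0r truncn0 mod0n.
set x := \sum_(l < m) (t l.+1)%:R * b%:R ^- l.+1 : R.
have x01 : 0 <= x < 1.
  rewrite sumr_ge0 => [|l _]; last by rewrite mulr_ge0 ?invr_ge0 ?exprn_ge0.
  apply: le_lt_trans (@sum_digits_le R b m (fun l => t l.+1) b1 _) _ => //.
  by rewrite ltrBlDr ltrDl invr_gt0 exprn_gt0 // ltr0n; lia.
have -> : \sum_(l < m.+1) (t l)%:R * b%:R ^- l.+1 = ((t 0%N)%:R + x) / b%:R :> R.
  rewrite big_ord_recl expr1 mulrDl mulr_suml; congr (_ + _).
  by apply: eq_bigr => l _; rewrite /= /bump /= add1n [b%:R ^+ l.+2]exprSr invfM mulrA.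
rewrite /radix_digit exprS mulrA divfK //.
case: i => [|i] /=.
  rewrite expr0 mulr1 (@truncn_def _ _ (t 0%N)) ?modn_small //.
  by rewrite -[_.+1%:R]natr1 lerDl ltrD2l.
have -> : ((t 0%N)%:R + x) * b%:R ^+ i.+1 = (t 0 * b ^ i.+1)%N%:R + x * b%:R ^+ i.+1.
  by rewrite mulrDl natrM natrX.
have x0 : x * b%:R ^+ i.+1 \in Num.nneg.
  by rewrite nnegrE mulr_ge0 ?exprn_ge0 //; case/andP: x01.
rewrite truncnD ?natr_nat // natrK expnSr mulnA modnMDl ltnS.
exact: (IHm i (fun l => t l.+1)).
Qed.

Lemma sum_ord_mul (V : nmodType) (m a : nat) (F : nat -> nat -> V) :
  \sum_(i < m * a) F (i %/ a)%N (i %% a)%N = \sum_(i < m) \sum_(j < a) F i j.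
Proof.
elim: m => [|m IHm]; first by rewrite mul0n !big_ord0.
rewrite big_ord_recr /= -IHm mulSn addnC big_split_ord /=; congr (_ + _).
apply: eq_bigr => j _; have a0 : (0 < a)%N by apply: leq_ltn_trans (ltn_ord j).
by rewrite divnMDl // modnMDl divn_small ?modn_small ?addn0.
Qed.

(** Coordinates with at most m digits make the partial sums constant from index m on, so the limit
    is a finite sum. *)
Lemma digit_interlaceE (R : realType) (b m a : nat) (x : 'I_a -> R)
    (t : nat -> nat -> nat) :
  (forall (j : 'I_a) i, radix_digit b (x j) i.+1 = if (i < m)%N then t j i else 0%N) ->
  digit_interlace b x =
  \sum_(i < m * a) (t (i %% a)%N (i %/ a)%N)%:R * b%:R ^- i.+1.
Proof.
move=> xt; pose G i j : R := (t j i)%:R * b%:R ^- (j.+1 + i * a).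
transitivity (\sum_(i < m) \sum_(j < a) G i j); last first.
  rewrite -sum_ord_mul; apply: eq_bigr => i _; rewrite /G.
  by rewrite addSn [(i %% a + _)%N]addnC -divn_eq.
apply: lim_near_cst; first exact: Rhausdorff.
near=> n; have mn : (m <= n)%N by near: n; exact: nbhs_infty_ge.
rewrite /series /= big_mkord -(subnKC mn) big_split_ord /= [X in _ + X]big1 ?addr0.
  by apply: eq_bigr => i _; apply: eq_bigr => j _; rewrite xt ltn_ord.
move=> i _; rewrite big1 // => j _; rewrite xt ltnNge leq_addr mul0r //.
Unshelve. all: by end_near. Qed.

Lemma interlaced_gridpt (R : realType) (b a s m : nat) (P : {poly 'F_b})
    (g : digits b (a.+1 * s) m) (n : nat) : prime b ->
  interlace_row b (poly_lattice_point R m P (fun j => ffpoly (g j)) n) =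
  gridpt R (interlaced_digits P g (base_digits b m n)).
Proof.
move=> pb; apply/rowP => k; rewrite !mxE.
pose t j l : nat := laurent_frac (ffpoly (base_digits b m n) *
   ffpoly (g (block_index k (inord j : 'I_a.+1)))) P l.+1%:Z.
rewrite (@digit_interlaceE _ _ m _ _ t) => [|j i].
  by apply: eq_bigr => i _; rewrite !ffunE.
rewrite -(@radix_digit_sum R b m (t j)) ?prime_gt1 => // [|l]; last exact: ltn_Fp.
congr (radix_digit _ _ _); rewrite mxE /vtrunc big_add1 /= big_mkord.
by apply: eq_bigr => l _; rewrite digit_poly_ffpoly /t inord_val.
Qed.

(** Jensen's inequality for sums: with T the sum of the p-th powers, W = W^p (W^p)^(1/p - 1) <= W^p
    T^(1/p - 1). *)
Lemma sum_le_powR (R : realType) (I : finType) (P : pred I) (W : I -> R) (p : R) :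
  0 < p <= 1 -> (forall i, 0 <= W i) ->
  \sum_(i | P i) W i <= (\sum_(i | P i) W i `^ p) `^ p^-1.
Proof.
move=> /andP[p0 p1] W0; set T := \sum_(i | P i) W i `^ p.
have T0 : 0 <= T by rewrite sumr_ge0 // => i _; exact: powR_ge0.
have WT i : P i -> W i `^ p <= T.
  by move=> Pi; rewrite /T (bigD1 i) //= lerDl sumr_ge0 // => j _; exact: powR_ge0.
have pV : 1 + (p^-1 - 1) = p^-1 by rewrite addrC subrK.
have -> : T `^ p^-1 = T * T `^ (p^-1 - 1).
  by rewrite -{2}[T]powRr1 // -powRD ?pV // invr_eq0 gt_eqF.
rewrite {1}/T mulr_suml; apply: ler_sum => i Pi.
apply: le_trans (_ : W i `^ p * (W i `^ p) `^ (p^-1 - 1) <= _).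
  have pE : p + p * (p^-1 - 1) = 1.
    by rewrite mulrBr mulfV ?gt_eqF // mulr1 addrC subrK.
  by rewrite -powRrM -powRD pE ?oner_eq0 // powRr1.
rewrite ler_wpM2l ?powR_ge0 // ge0_ler_powR ?nnegrE ?powR_ge0 ?WT //.
by rewrite subr_ge0 invf_ge1.
Qed.

(** The reference is the grid of mesh b^-(m (a+1)) rather than the integral. The generating vector
    is selected from the weights alone, before f and c are given. *)
Lemma exists_rule (R : realType) (b a : nat) (p : R) (chi : nat -> R) :
  prime b -> 0 < p < 1 -> 1 < p * a.+1%:R -> (forall j, 0 < chi j) ->
  cvgn (series (fun j => chi j `^ p)) ->
  exists2 C : R, 0 <= C & forall s m, (0 < m)%N ->
  exists x : 'I_(b ^ m) -> 'rV[R]_s,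
  [/\ @interlaced_poly_lattice_rule R b a.+1 m s x, forall n, cube (x n) &
   forall (f : 'rV[R]_s -> R) (c : R), has_mixed_pderives a.+1 f ->
   (forall (nu : multi_index s) z, cube z -> (forall j, (nu j <= a.+1)%N) ->
     `|mixed_pderive nu f z| <= c * (mi_abs nu)`!%:R * mi_pow chi nu) ->
   `|#|{: digits b s (m * a.+1)}|%:R^-1 *
        (\sum_(y : digits b s (m * a.+1)) f (gridpt R y)) -
     (b ^ m)%N%:R^-1 * \sum_n f (x n)| <= c * (C * b%:R `^ (- (m%:R / p)))].
Proof.
move=> pb p01 pa chi0 chi_cv; have /andP[p0 p1] := p01.
have b0 : 0 < b%:R :> R by rewrite ltr0n prime_gt0.
have [S hS] := sum_walsh_weight pb p01 pa chi0 chi_cv.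
exists (S `^ p^-1) => [|s m m0]; first exact: powR_ge0.
have [P [irrP sP]] := exists_irreducible_poly pb m0.
pose W (k : digits b s (m * a.+1)) := walsh_weight a.+1 chi k.
have W0 k : 0 <= W k by exact: walsh_weight_ge0.
have [|g hg] := exists_small_dual_sum pb irrP sP _ (hS s (m * a.+1)%N).
  by move=> k; exact: powR_ge0.
pose x (n : 'I_(b ^ m)) : 'rV[R]_s :=
  gridpt R (interlaced_digits P g (base_digits b m n)).
exists x; split.
- exists P, (fun j => ffpoly (g j)); split=> // [j|n]; first exact: size_ffpoly.
  by rewrite interlaced_gridpt.
- by move=> n; exact: cube_gridpt.
move=> f c sf fB.
have c0 : 0 <= c := pderive_bound_ge0 fB.
have -> : (b ^ m)%N%:R^-1 * \sum_n f (x n) =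
    #|{: {ffun 'I_m -> 'F_b}}|%:R^-1 *
    \sum_v (f \o gridpt R (n := m * a.+1)) (interlaced_digits P g v).
  rewrite card_ffun card_Fp // card_ord; congr (_ * _).
  by rewrite (reindex _ (onW_bij _ (base_digits_bij m pb))).
rewrite mean_walsh // => [|u v]; last exact: interlaced_digitsDr.
(* The zero array always lies in the dual and its coefficient is the grid mean. What remains is the
   sum over the nonzero dual. *)
rewrite [X in _ - X](bigD1 0) /=; last first.
  apply/forallP => v; rewrite dotC /dot big1 // => j _.
  by rewrite big1 // => i _; rewrite !ffunE mulr0.
rewrite walsh_coef0 /= opprD addrA subrr sub0r normrN.
apply: le_trans (ler_norm_sum _ _ _) _.
apply: le_trans (_ : \sum_(k | (k != 0) && in_dual P g k) c * W k <= _).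
  rewrite (eq_bigl (fun k => (k != 0) && in_dual P g k)) => [|k]; last first.
    by rewrite andbC.
  by apply: ler_sum => k _; exact: walsh_coef_weight.
rewrite -mulr_sumr ler_wpM2l //.
have p01' : 0 < p <= 1 by rewrite p0 ltW.
apply: le_trans (sum_le_powR _ p01' W0) _.
apply: le_trans (_ : (b%:R ^- m * S) `^ p^-1 <= _).
  rewrite ge0_ler_powR ?nnegrE ?invr_ge0 ?(ltW p0) ?sumr_ge0 // => [k _|].
    exact: powR_ge0.
  by apply: le_trans hg; rewrite sumr_ge0 // => k _; exact: powR_ge0.
have S0 : 0 <= S.
  by apply: le_trans (hS 0%N 0%N); rewrite sumr_ge0 // => k _; exact: powR_ge0.
rewrite powRM ?invr_ge0 ?exprn_ge0 // mulrC ler_wpM2l ?powR_ge0 //.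
by rewrite -powR_invn ?(ltW b0) // -powRrM mulNr.
Qed.

(** * Integration over the cube *)

Definition cube_lipschitz (R : realType) (s : nat) (f : 'rV[R]_s -> R)
    (K : 'I_s -> R) : Prop :=
  forall y j h, cube y -> 0 <= h -> cube (y - h *: delta_mx 0 j) ->
  `|f y - f (y - h *: delta_mx 0 j)| <= K j * h.

(** Coordinates are moved from x to y one at a time; [z l] has those in l already moved. *)
Lemma cube_lipschitz_le (R : realType) (s : nat) (f : 'rV[R]_s -> R)
    (K : 'I_s -> R) (x y : 'rV[R]_s) (d : R) :
  cube_lipschitz f K -> (forall j, 0 <= K j) -> cube x -> cube y ->
  (forall j, 0 <= x 0 j - y 0 j <= d) ->
  `|f x - f y| <= (\sum_j K j) * d.
Proof.
move=> fK K0 cx cy xyd.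
pose z (l : seq 'I_s) : 'rV[R]_s := \row_j (if j \in l then y 0 j else x 0 j).
have cz l : cube (z l) by move=> j; rewrite mxE; case: ifP.
suff H l : uniq l -> `|f x - f (z l)| <= \sum_(j <- l) K j * d.
  have := H (enum 'I_s) (enum_uniq _); rewrite big_enum /= -mulr_suml.
  suff -> : z (enum 'I_s) = y by [].
  by apply/rowP => j; rewrite mxE mem_enum.
elim: l => [_|i l IHl /= /andP[il ul]].
  rewrite big_nil (_ : z [::] = x) ?subrr ?normr0 //.
  by apply/rowP => j; rewrite mxE.
have zE : z (i :: l) = z l - (x 0 i - y 0 i) *: delta_mx 0 i.
  apply/rowP => j; rewrite !mxE in_cons eqxx /=.
  have [->|ji] := eqVneq j i; last by rewrite mulr0 subr0.
  by rewrite (negPf il) mulr1 opprB addrC subrK.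
have /andP[xy0 xyd'] := xyd i.
have := fK (z l) i _ (cz l) xy0; rewrite -zE => /(_ (cz _)) h.
rewrite big_cons [leRHS]addrC; apply: le_trans (ler_distD (f (z l)) _ _) _.
rewrite lerD ?IHl //; apply: le_trans h _; exact: ler_wpM2l.
Qed.

Lemma measurable_box (R : realType) (s : nat)
    (A : 'I_s -> set (measurableTypeR R)) : (forall j, measurable (A j)) ->
  measurable [set t : s.-tuple (measurableTypeR R) | forall j, A j (tnth t j)].
Proof.
move=> mA; rewrite (_ : [set _ | _] = \bigcap_(j in [set: 'I_s])
    ((fun t : s.-tuple (measurableTypeR R) => tnth t j) @^-1` A j)); last first.
  by apply/seteqP; split=> t /= h j; [move=> _; exact: h | exact: (h j I)].
apply: fin_bigcap_measurable => [|j _]; first exact: finite_finset.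
by rewrite -[X in measurable X]setTI; apply: (@measurable_tnth _ _ s j).
Qed.

Lemma cube_measure_box (R : realType) (s : nat)
    (A : 'I_s -> set (measurableTypeR R)) (r : 'I_s -> R) :
  (forall j, measurable (A j)) ->
  (forall j, uniform_prob (@ltr01 R) (A j) = (r j)%:E) ->
  cube_measure R s [set t | forall j, A j (tnth t j)] = (\prod_j r j)%:E.
Proof.
elim: s A r => [|s IHs] A r mA Ar /=.
  by rewrite diracE big_ord0 mem_set // => -[].
rewrite /distribution /pushforward /=.
rewrite (_ : _ @^-1` _ = A ord0 `*`
    [set t | forall j, A (lift ord0 j) (tnth t j)]); last first.
  apply/seteqP; split=> [[x t] /= h|[x t] /= [h0 h] j].
    split; first by have := h ord0; rewrite /cons_tuple tnth0.
    by move=> j; have := h (lift ord0 j); rewrite /cons_tuple tnthS.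
  rewrite /cons_tuple; case: (unliftP ord0 j) => [j'|] ->; last by rewrite tnth0.
  by rewrite tnthS.
rewrite product_measure1E //; last first.
  by apply: (@measurable_box _ _ (fun j => A (lift ord0 j))) => j; exact: mA.
have /= IH := IHs (fun j => A (lift ord0 j)) (fun j => r (lift ord0 j))
  (fun=> mA _) (fun=> Ar _).
by rewrite big_ord_recl EFinM -IH -Ar.
Qed.

(* The last cell is closed, so that the cells partition [0, 1]. *)
Definition cell (R : realType) (N i : nat) : set (measurableTypeR R) :=
  [set` Interval (BLeft (i%:R / N%:R)) (BSide (i.+1 < N)%N (i.+1%:R / N%:R))].

Lemma cell_sub (R : realType) (N i : nat) (x : R) : (i < N)%N ->
  cell N i x -> i%:R / N%:R <= x <= i.+1%:R / N%:R.
Proof.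
move=> iN; rewrite /cell /= itv_boundlr /= !bnd_simp => /andP[->] /=.
by case: (i.+1 < N)%N; rewrite bnd_simp // => /ltW.
Qed.

Lemma uniform_prob_cell (R : realType) (N i : nat) : (i < N)%N ->
  uniform_prob (@ltr01 R) (cell N i) = (N%:R^-1)%:E.
Proof.
move=> iN; have N0 : 0 < N%:R :> R by rewrite ltr0n; lia.
rewrite /uniform_prob (eq_integral (fun=> 1%E)) => [|x]; last first.
  rewrite inE => /(cell_sub iN) /andP[ix xi]; rewrite /uniform_pdf subr0 invr1.
  rewrite ifT // (le_trans _ ix) ?divr_ge0 //= (le_trans xi) //.
  by rewrite ler_pdivrMr // mul1r ler_nat.
rewrite integral_cst //; last exact: measurable_itv.
rewrite mul1e; apply: etrans (lebesgue_measure_itv _) _; rewrite /=.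
have E : i.+1%:R / N%:R - i%:R / N%:R = N%:R^-1 :> R.
  by rewrite -mulrBl -[i.+1%:R]natr1 addrAC subrr add0r mul1r.
rewrite ifT ?EFinN ?E -?EFinB ?E // lte_fin -subr_gt0 E invr_gt0 //.
Qed.

(** On [0, 1] the minimum acts only at x = 1, which belongs to the closed last cell. *)
Definition cell_index (R : realType) (N : nat) (x : R) : nat :=
  minn (Num.truncn (x * N%:R)) N.-1.

Lemma cell_index_lt (R : realType) (N : nat) (x : R) : (0 < N)%N ->
  (cell_index N x < N)%N.
Proof.
by move=> N0; rewrite /cell_index; have := geq_minr (Num.truncn (x * N%:R)) N.-1; lia.
Qed.

Lemma cellP (R : realType) (N i : nat) (x : R) : (i < N)%N -> 0 <= x <= 1 ->
  cell N i x <-> i = cell_index N x.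
Proof.
move=> iN /andP[x0 x1]; have N0 : 0 < N%:R :> R by rewrite ltr0n; lia.
have /andP[tx xt] : (Num.truncn (x * N%:R))%:R <= x * N%:R <
    (Num.truncn (x * N%:R)).+1%:R by rewrite truncn_itv // mulr_ge0 // ltW.
have xN : x * N%:R <= N%:R by rewrite ler_piMl // ltW.
rewrite /cell /= itv_boundlr /= bnd_simp ler_pdivrMr // /cell_index.
split.
  move=> /andP[ix]; case: ltnP => iN1; rewrite bnd_simp.
    rewrite ltr_pdivlMr // => xi.
    by rewrite (@truncn_def _ _ i) ?ix //; lia.
  move=> _; have : (i <= Num.truncn (x * N%:R))%N by rewrite truncn_ge_nat // mulr_ge0 // ltW.
  by lia.
move=> iE; apply/andP; split.
  by apply: le_trans tx; rewrite ler_nat iE geq_minl.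
case: ltnP => iN1; rewrite bnd_simp.
  rewrite ltr_pdivlMr //; suff -> : i = Num.truncn (x * N%:R) by [].
  by rewrite iE; rewrite iE in iN1; lia.
by rewrite ler_pdivlMr // (le_trans xN) // ler_nat.
Qed.

Definition cell_box (R : realType) (N s : nat) (d : {ffun 'I_s -> 'I_N}) :
    set (s.-tuple (measurableTypeR R)) :=
  [set t | forall j, cell N (d j) (tnth t j)].

Definition cell_corner (R : realType) (N s : nat) (d : {ffun 'I_s -> 'I_N}) :
    'rV[R]_s := \row_j ((d j : nat)%:R / N%:R).

Lemma measurable_cell_box (R : realType) (N s : nat) (d : {ffun 'I_s -> 'I_N}) :
  measurable (@cell_box R N s d).
Proof.
by apply: (@measurable_box _ _ (fun j => cell N (d j))) => j; exact: measurable_itv.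
Qed.

Lemma cube_measure_cell_box (R : realType) (N s : nat) (d : {ffun 'I_s -> 'I_N}) :
  cube_measure R s (cell_box d) = ((N%:R ^+ s)^-1)%:E.
Proof.
rewrite /cell_box (@cube_measure_box _ _ (fun j => cell N (d j)) (fun=> N%:R^-1)).
- by rewrite prodr_const card_ord exprVn.
- by move=> j; exact: measurable_itv.
- by move=> j; exact: uniform_prob_cell.
Qed.

Lemma cube_corner (R : realType) (N s : nat) (d : {ffun 'I_s -> 'I_N}) :
  cube (cell_corner R d).
Proof.
move=> j; rewrite mxE divr_ge0 //=; have dN := ltn_ord (d j).
by rewrite ler_pdivrMr ?mul1r ?ler_nat ?ltr0n //; lia.
Qed.

Lemma measurable_cube_tuple (R : realType) (s : nat) :
  measurable [set t : s.-tuple (measurableTypeR R) | cube (row_of_tuple t)].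
Proof.
rewrite (_ : [set _ | _] = [set t | forall j, [set` `[0 : R, 1]] (tnth t j)]).
  by apply: (@measurable_box _ _ (fun=> [set` `[0 : R, 1]])) => j; exact: measurable_itv.
by apply/seteqP; split=> t /= h j; have := h j; rewrite mxE in_itv.
Qed.

Definition step_fun (R : realType) (N s : nat) (f : 'rV[R]_s -> R)
    (t : s.-tuple (measurableTypeR R)) : R :=
  \sum_(d : {ffun 'I_s -> 'I_N}) f (cell_corner R d) * \1_(cell_box d) t.

Lemma step_fun_near (R : realType) (N s : nat) (f : 'rV[R]_s -> R)
    (K : 'I_s -> R) (t : s.-tuple (measurableTypeR R)) :
  (0 < N)%N -> cube_lipschitz f K -> (forall j, 0 <= K j) ->
  cube (row_of_tuple t) ->
  `|f (row_of_tuple t) - step_fun N f t| <= (\sum_j K j) * N%:R^-1.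
Proof.
move=> N0 fK K0 ct.
pose d : {ffun 'I_s -> 'I_N} :=
  [ffun j => Ordinal (cell_index_lt (row_of_tuple t 0 j) N0)].
have td : cell_box d t.
  move=> j; have := @cellP R N (d j) _ (ltn_ord _) (ct j); rewrite mxE => h.
  by apply/h; rewrite ffunE /= mxE.
have -> : step_fun N f t = f (cell_corner R d).
  rewrite /step_fun (bigD1 d) //= indicE mem_set // mulr1 big1 ?addr0 //.
  move=> d' d'd; rewrite indicE memNset ?mulr0 // => td'; case/eqP: d'd.
  apply/ffunP => j; apply: val_inj; rewrite ffunE /=.
  have := @cellP R N (d' j) _ (ltn_ord _) (ct j); rewrite mxE => h.
  exact/h/td'.
apply: cube_lipschitz_le => // [|j]; first exact: cube_corner.
rewrite !mxE; have := cell_sub (ltn_ord _) (td j).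
by rewrite -[(d j).+1%:R]natr1 mulrDl mul1r; lra.
Qed.

Lemma measurable_step_fun (R : realType) (N s : nat) (f : 'rV[R]_s -> R) :
  measurable_fun setT (@step_fun R N s f).
Proof.
apply: measurable_sum => d; apply: measurable_funM => //.
apply: measurable_indic; exact: measurable_cell_box.
Qed.

(** Such a function is the pointwise limit on the cube of its step functions on grids of mesh
    1/(n+1). *)
Lemma measurable_cube_lipschitz (R : realType) (s : nat) (f : 'rV[R]_s -> R)
    (K : 'I_s -> R) :
  cube_lipschitz f K -> (forall j, 0 <= K j) ->
  measurable_fun [set t : s.-tuple (measurableTypeR R) | cube (row_of_tuple t)]
    (fun t => f (row_of_tuple t)).
Proof.
move=> fK K0; apply: (@measurable_fun_cvg _ _ _ _ (fun n => @step_fun R n.+1 s f)).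
  move=> n; apply: measurable_funTS; exact: measurable_step_fun.
move=> t ct; apply/cvgrPdist_le => e e0; near=> n.
apply: le_trans (step_fun_near _ fK K0 ct) _ => //.
have S0 : 0 <= \sum_j K j by rewrite sumr_ge0.
rewrite ler_pdivrMr ?ltr0n // mulrC -ler_pdivrMr //.
apply: le_trans (_ : n%:R <= _); last by rewrite ler_nat.
near: n; exact: nbhs_infty_ger.
Unshelve. all: by end_near. Qed.

Lemma cube_integral_grid (R : realType) (N s : nat) (f : 'rV[R]_s -> R)
    (K : 'I_s -> R) : (0 < N)%N ->
  cube_lipschitz f K -> (forall j, 0 <= K j) ->
  `|cube_integral f - (N%:R ^+ s)^-1 *
     \sum_(d : {ffun 'I_s -> 'I_N}) f (cell_corner R d)| <= (\sum_j K j) * N%:R^-1.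
Proof.
move=> N0 fK K0; set D := [set t : s.-tuple (measurableTypeR R) | cube (row_of_tuple t)].
set mu := cube_measure R s.
have mD : measurable D := @measurable_cube_tuple R s.
have muD : mu D = 1%E.
  rewrite /D (_ : [set _ | _] = [set t | forall j, [set` `[0 : R, 1]] (tnth t j)]); last first.
    by apply/seteqP; split=> t /= h j; have := h j; rewrite mxE in_itv.
  rewrite (@cube_measure_box R s (fun=> [set` `[0 : R, 1]]) (fun=> 1)) ?big1 //.
  by move=> j; exact: (integral_uniform_pdf1 (@ltr01 R)).
have muDoo : (mu D < +oo)%E by rewrite muD ltry.
have bounded_int (h : s.-tuple (measurableTypeR R) -> R) (M : R) :
    measurable_fun D h -> (forall t, D t -> `|h t| <= M) ->
    mu.-integrable D (EFin \o h).
  move=> mh hM; apply: measurable_bounded_integrable => //.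
  by exists M; split=> [|x Mx t Dt]; [exact: num_real | exact: le_trans (hM t Dt) (ltW Mx)].
have S0 : 0 <= \sum_j K j by rewrite sumr_ge0.
set e := (\sum_j K j) * N%:R^-1.
have istep (d : {ffun 'I_s -> 'I_N}) :
    mu.-integrable D (EFin \o (fun t => f (cell_corner R d) * \1_(cell_box d) t)).
  apply: (bounded_int (fun t => f (cell_corner R d) * \1_(cell_box d) t)
    `|f (cell_corner R d)|) => [|t _].
    apply: measurable_funM => //.
    by apply: measurable_funTS; apply: measurable_indic; exact: measurable_cell_box.
  rewrite normrM ler_piMr // indicE; case: (_ \in _); rewrite ?normr0 ?normr1 //.
have sE : EFin \o @step_fun R N s f =
    (fun t => \sum_(d : {ffun 'I_s -> 'I_N})
       (f (cell_corner R d) * \1_(cell_box d) t)%R%:E)%E.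
  by apply/funext => t; rewrite /= sumEFin.
have int_step : mu.-integrable D (EFin \o @step_fun R N s f).
  by rewrite sE; apply: integrable_sum => // d _; exact: istep.
have near_step t : D t -> `|f (row_of_tuple t) - step_fun N f t| <= e.
  by move=> Dt; exact: step_fun_near.
have int_diff : mu.-integrable D (EFin \o (fun t => f (row_of_tuple t) - step_fun N f t)).
  apply: (bounded_int (fun t => f (row_of_tuple t) - step_fun N f t) e) => //.
  apply: measurable_funB.
    exact: measurable_cube_lipschitz fK K0.
  by apply: measurable_funTS; exact: measurable_step_fun.
(* f differs from an integrable step function by a bounded measurable function. *)
have int_f : mu.-integrable D (EFin \o (fun t => f (row_of_tuple t))).
  rewrite (_ : EFin \o _ = ((EFin \o (fun t => (f (row_of_tuple t) - step_fun N f t)%R))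
    \+ (EFin \o @step_fun R N s f))%E); first exact: integrableD.
  by apply/funext => t; rewrite /= -EFinD subrK.
(* The grid mean is the integral of the step function, every cell having measure N^-s. *)
have -> : (N%:R ^+ s)^-1 * (\sum_(d : {ffun 'I_s -> 'I_N}) f (cell_corner R d)) =
    \int[mu]_(t in D) step_fun N f t.
  rewrite /Rintegral -[fun t => _%:E]/(EFin \o @step_fun R N s f) sE integral_sum //.
  rewrite (eq_bigr (fun d : {ffun 'I_s -> 'I_N} =>
      (f (cell_corner R d) * (N%:R ^+ s)^-1)%:E)) => [|d _].
    by rewrite sumEFin /= -mulr_suml mulrC.
  rewrite /= (eq_integral (fun t => (f (cell_corner R d))%:E * (\1_(cell_box d) t)%:E)%E) //.
  rewrite integralZl //; last first.
    by apply: integrableS (integrable_indic _ (measurable_cell_box d)).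
  rewrite integral_indic //; last exact: measurable_cell_box.
  suff -> : cell_box d `&` D = cell_box d by rewrite EFinM -(cube_measure_cell_box R d).
  apply/seteqP; split=> [t []//|t td]; split=> // j; rewrite mxE.
  have /andP[h1 h2] := cell_sub (ltn_ord (d j)) (td j).
  rewrite (le_trans _ h1) ?divr_ge0 //= (le_trans h2) //.
  by rewrite ler_pdivrMr ?mul1r ?ler_nat ?ltr0n.
rewrite /cube_integral -/D -/mu -RintegralB //.
apply: le_trans (le_normr_Rintegral _ _) _ => //.
have -> : e = \int[mu]_(t in D) e by rewrite Rintegral_cst // -[LHS]mulr1 -[1]/(fine 1%E) -muD.
apply: le_Rintegral => //.
- exact: (@integrable_abse _ _ _ _ _ (EFin \o _)).
- by apply: (bounded_int (fun=> e) e) => // t _; rewrite ger0_norm // mulr_ge0 // invr_ge0.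
Qed.

(** * Error of the sparse grid *)

Lemma le_of_invn_le (R : realType) (x y K : R) :
  (forall N, (0 < N)%N -> x <= y + K * N%:R^-1) -> x <= y.
Proof.
move=> h; apply/ler_addgt0Pr => e e0.
pose N := (Num.truncn (`|K| / e)).+1.
have N0 : 0 < N%:R :> R by rewrite ltr0n.
apply: le_trans (h N _) _ => //; rewrite lerD2l ler_pdivrMr // mulrC.
rewrite -ler_pdivrMr //; apply: le_trans (ltW (truncnS_gt _)).
by rewrite ler_pM2r ?invr_gt0 // ler_norm.
Qed.

Definition mean (R : realType) (I : finType) (h : I -> R) : R :=
  #|I|%:R^-1 * \sum_i h i.

Lemma normr_mean_le (R : realType) (I : finType) (h : I -> R) (K : R) :
  (0 < #|I|)%N -> (forall i, `|h i| <= K) -> `|mean h| <= K.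
Proof.
move=> I0 hK; rewrite normrM ger0_norm ?invr_ge0 // ler_pdivrMl ?ltr0n //.
rewrite mulr_natl -sumr_const; apply: le_trans (ler_norm_sum _ _ _) _.
exact: ler_sum.
Qed.

Lemma meanB (R : realType) (I : finType) (h k : I -> R) :
  mean h - mean k = mean (fun i => h i - k i).
Proof. by rewrite /mean -mulrBr sumrB. Qed.

Lemma mean_exchange (R : realType) (I J : finType) (h : I -> J -> R) :
  mean (fun i => mean (h i)) = mean (fun j => mean (h^~ j)).
Proof.
by rewrite /mean -!mulr_sumr exchange_big /= mulrCA.
Qed.

Lemma mean_near (R : realType) (I : finType) (h k : I -> R) (K : R) :
  (0 < #|I|)%N -> (forall i, `|h i - k i| <= K) -> `|mean h - mean k| <= K.
Proof. by move=> I0 hk; rewrite meanB normr_mean_le. Qed.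

Lemma card_grid_gt0 (N s : nat) : (0 < N)%N -> (0 < #|{: {ffun 'I_s -> 'I_N}}|)%N.
Proof. by move=> N0; rewrite card_ffun !card_ord expn_gt0 N0. Qed.

Lemma cube_integral_mean (R : realType) (N s : nat) (f : 'rV[R]_s -> R)
    (K : 'I_s -> R) : (0 < N)%N ->
  cube_lipschitz f K -> (forall j, 0 <= K j) ->
  `|cube_integral f - mean (fun d : {ffun 'I_s -> 'I_N} => f (cell_corner R d))|
    <= (\sum_j K j) * N%:R^-1.
Proof.
move=> N0 fK K0; have := cube_integral_grid N0 fK K0.
by rewrite /mean card_ffun !card_ord natrX.
Qed.

(** Every grid mean over y satisfies the estimate with the same constants [K2], and the integral is
    a limit of such means. *)
Lemma cube_lipschitz_integral (R : realType) (s1 s2 : nat)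
    (F : 'rV[R]_s1 -> 'rV[R]_s2 -> R) (K1 : 'I_s1 -> R) (K2 : 'I_s2 -> R) :
  (forall z, cube z -> cube_lipschitz (F^~ z) K1) -> (forall j, 0 <= K1 j) ->
  (forall y, cube y -> cube_lipschitz (F y) K2) ->
  cube_lipschitz (fun z => cube_integral (F^~ z)) K2.
Proof.
move=> F1 K10 F2 z j h cz h0 cz'.
apply: (@le_of_invn_le _ _ _ (2 * \sum_j K1 j)) => N N0.
have h1 := cube_integral_mean N0 (F1 _ cz) K10.
have h2 := cube_integral_mean N0 (F1 _ cz') K10.
have : `|mean (fun d : {ffun 'I_s1 -> 'I_N} => F (cell_corner R d) z) -
    mean (fun d : {ffun 'I_s1 -> 'I_N} => F (cell_corner R d) (z - h *: delta_mx 0 j))|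
    <= K2 j * h.
  apply: mean_near; first exact: card_grid_gt0.
  by move=> d; apply: F2 => //; exact: cube_corner.
move: h1 h2; rewrite !ler_norml; lra.
Qed.

Definition rule_mean (R : realType) (s n : nat) (x : 'I_n -> 'rV[R]_s)
    (f : 'rV[R]_s -> R) : R := mean (fun i => f (x i)).

Lemma tensor_ruleE (R : realType) (s1 s2 n1 n2 : nat)
    (x : 'I_n1 -> 'rV[R]_s1) (w : 'I_n2 -> 'rV[R]_s2)
    (F : 'rV[R]_s1 -> 'rV[R]_s2 -> R) :
  tensor_rule x w F = rule_mean w (fun z => rule_mean x (F^~ z)).
Proof.
by rewrite /tensor_rule /rule_mean /mean !card_ord -mulr_sumr invfM mulrA [n2%:R^-1 * _]mulrC.
Qed.

(** Up to the midpoint the accurate rule is the one in y, beyond it the one in z. Each summand is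
    bounded by whichever error is smaller, using estimates in one variable block at a time. *)
Lemma sparse_grid_error (R : realType) (s1 s2 : nat) (N1 N2 : nat -> nat)
    (x : forall j, 'I_(N1 j) -> 'rV[R]_s1)
    (w : forall j, 'I_(N2 j) -> 'rV[R]_s2)
    (F : 'rV[R]_s1 -> 'rV[R]_s2 -> R) (K1 : 'I_s1 -> R) (K2 : 'I_s2 -> R)
    (A rho : R) (L : nat) :
  (forall j, (0 < N1 j)%N) -> (forall j, (0 < N2 j)%N) ->
  (forall j i, (0 < j)%N -> cube (x j i)) ->
  (forall j i, (0 < j)%N -> cube (w j i)) ->
  (forall z, cube z -> cube_lipschitz (F^~ z) K1) -> (forall j, 0 <= K1 j) ->
  (forall y, cube y -> cube_lipschitz (F y) K2) -> (forall j, 0 <= K2 j) ->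
  (forall j z, (0 < j)%N -> cube z ->
     `|cube_integral (F^~ z) - rule_mean (x j) (F^~ z)| <= A * rho ^+ j) ->
  (forall k y, (0 < k)%N -> cube y ->
     `|cube_integral (F y) - rule_mean (w k) (F y)| <= A * rho ^+ k) ->
  0 <= A -> 0 <= rho <= 1 -> (2 <= L)%N ->
  `|integral2 F - sparse_grid x w L F| <= A * (rho ^+ L.-1 +
    \sum_(1 <= k < L) (if (2 * k <= L)%N then 2 * rho ^+ (L - k)
                       else 4 * rho ^+ k.-1)).
Proof.
move=> N10 N20 cx cw F1 K10 F2 K20 errx errw A0 rho01 L2.
pose G z := cube_integral (F^~ z).
have card1 j : (0 < #|'I_(N1 j)|)%N by rewrite card_ord.
have card2 j : (0 < #|'I_(N2 j)|)%N by rewrite card_ord.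
have GK : cube_lipschitz G K2 by exact: cube_lipschitz_integral F1 K10 F2.
(* The z-rule of level k applied to the exact integral over y. The value 0 at k = 0 mirrors the
   convention in [level_rule] and makes the differences telescope to P (L-1). *)
pose P k := if k is 0 then 0 else rule_mean (w k) G.
have telescope : P L.-1 = \sum_(1 <= k < L) (P k - P k.-1).
  rewrite big_add1 (eq_bigr (fun k => P k.+1 - P k)) // telescope_sumr //.
  by rewrite subr0.
(* The integral over y is replaced by means over grids of mesh 1/N, N -> oo,
   which commute with the rules in z. *)
have P_near k N : (0 < k)%N -> (0 < N)%N ->
  `|P k - mean (fun d : {ffun 'I_s1 -> 'I_N} => rule_mean (w k) (F (cell_corner R d)))|
    <= (\sum_j K1 j) * N%:R^-1.
  case: k => // k _ N0; rewrite /P /rule_mean mean_exchange.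
  apply: mean_near => // i; apply: cube_integral_mean => //.
  exact/F1/cw.
have errG k : (0 < k)%N -> `|integral2 F - P k| <= A * rho ^+ k.
  (* Four comparisons: discretise z, discretise y, replace the z-grid by the z-rule, and return to
     the integral over y. Each of the two grid errors occurs twice. *)
  move=> k0; apply: (@le_of_invn_le _ _ _ (2 * \sum_j K1 j + 2 * \sum_j K2 j)) => N N0.
  have h1 : `|integral2 F - mean (fun d : {ffun 'I_s2 -> 'I_N} => G (cell_corner R d))|
      <= (\sum_j K2 j) * N%:R^-1 by exact: cube_integral_mean.
  have h2 : `|mean (fun d : {ffun 'I_s2 -> 'I_N} => G (cell_corner R d)) -
     mean (fun d : {ffun 'I_s2 -> 'I_N} => mean (fun d' : {ffun 'I_s1 -> 'I_N} =>
       F (cell_corner R d') (cell_corner R d)))| <= (\sum_j K1 j) * N%:R^-1.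
    apply: mean_near => [|d]; first exact: card_grid_gt0.
    by apply: cube_integral_mean => //; exact/F1/cube_corner.
  have h3 : `|mean (fun d : {ffun 'I_s2 -> 'I_N} => mean (fun d' : {ffun 'I_s1 -> 'I_N} =>
       F (cell_corner R d') (cell_corner R d))) -
     mean (fun d : {ffun 'I_s1 -> 'I_N} => rule_mean (w k) (F (cell_corner R d)))|
     <= (\sum_j K2 j) * N%:R^-1 + A * rho ^+ k.
    rewrite mean_exchange; apply: mean_near => [|d]; first exact: card_grid_gt0.
    have cd := @cube_corner R N s1 d.
    have := cube_integral_mean N0 (F2 _ cd) K20; have := errw k _ k0 cd.
    by rewrite !ler_norml; lra.
  have := P_near k N k0 N0; move: h1 h2 h3; rewrite !ler_norml; lra.
have rho_le i j : (i <= j)%N -> rho ^+ j <= rho ^+ i.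
  by move=> ij; rewrite ler_wiXn2l //; case/andP: rho01.
have bnd_diff k : (1 < k)%N -> `|P k - P k.-1| <= 2 * A * rho ^+ k.-1.
  move=> k1; apply: (@le_of_invn_le _ _ _ (2 * \sum_j K1 j)) => N N0.
  have h : `|mean (fun d : {ffun 'I_s1 -> 'I_N} => rule_mean (w k) (F (cell_corner R d)))
     - mean (fun d : {ffun 'I_s1 -> 'I_N} => rule_mean (w k.-1) (F (cell_corner R d)))|
     <= 2 * A * rho ^+ k.-1.
    apply: mean_near => [|d]; first exact: card_grid_gt0.
    have cd := @cube_corner R N s1 d.
    have k0 : (0 < k.-1)%N by lia.
    have := errw k _ (ltnW k1) cd; have := errw k.-1 _ k0 cd.
    have : A * rho ^+ k <= A * rho ^+ k.-1 by rewrite ler_wpM2l ?rho_le ?leq_pred.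
    by rewrite !ler_norml; lra.
  have k0 : (0 < k.-1)%N by lia.
  have := P_near k N (ltnW k1) N0; have := P_near k.-1 N k0 N0.
  move: h; rewrite !ler_norml; lra.
pose Q j k := level_rule x w j k F.
have QE j k : (0 < j)%N -> (0 < k)%N ->
    Q j k = rule_mean (w k) (fun z => rule_mean (x j) (F^~ z)).
  by move=> j0 k0; rewrite /Q /level_rule !gtn_eqF //= tensor_ruleE.
have PQ j k : (0 < j)%N -> `|P k - Q j k| <= A * rho ^+ j.
  case: k => [|k] j0.
    rewrite /P /Q /level_rule orbT subrr normr0 mulr_ge0 // exprn_ge0 //.
    by case/andP: rho01.
  rewrite QE //; apply: mean_near => // i; apply: errx => //; exact: cw.
have Qdiff j k : (0 < j)%N -> (1 < k)%N -> `|Q j k - Q j k.-1| <= 2 * A * rho ^+ k.-1.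
  move=> j0 k1; have k0 : (0 < k.-1)%N by lia.
  rewrite !QE ?(ltnW k1) // /rule_mean mean_exchange [X in _ - X]mean_exchange.
  apply: mean_near => // i; have ci := cx j i j0.
  have := errw k _ (ltnW k1) ci; have := errw k.-1 _ k0 ci.
  have : A * rho ^+ k <= A * rho ^+ k.-1 by rewrite ler_wpM2l ?rho_le ?leq_pred.
  by rewrite !ler_norml /rule_mean; lra.
(* The sparse grid is the telescoping sum for P (L-1) with the y-integral in its k-th term replaced
   by the y-rule of level L-k. *)
have -> : integral2 F - sparse_grid x w L F = (integral2 F - P L.-1) +
    \sum_(1 <= k < L) ((P k - P k.-1) - (Q (L - k)%N k - Q (L - k)%N k.-1)).
  by rewrite sumrB -telescope /sparse_grid addrA subrK.
apply: le_trans (ler_normD _ _) _; rewrite mulrDr lerD ?errG //; first by lia.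
apply: le_trans (ler_norm_sum _ _ _) _; rewrite mulr_sumr.
rewrite !big_nat; apply: ler_sum => k /andP[k1 kL].
have Lk0 : (0 < L - k)%N by rewrite subn_gt0.
(* For 2k <= L, compare P with Q at equal z-level: two errors of the y-rule. Otherwise k > 1, and
   each of the two differences between z-levels k and k-1 is at most 2 A rho^(k-1). *)
case: leqP => k2.
  have := PQ _ k Lk0; have := PQ _ k.-1 Lk0.
  by rewrite !ler_norml; lra.
have k1' : (1 < k)%N by lia.
have := bnd_diff _ k1'; have := Qdiff _ _ Lk0 k1'.
by rewrite !ler_norml; lra.
Qed.

(** * Summation of the errors over the levels *)

Lemma sum_exp_dist (R : realType) (t : R) (h n : nat) : 0 <= t < 1 ->
  \sum_(k < n) t ^+ ((h - k) + (k - h)) <= 2 * (1 - t)^-1.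
Proof.
move=> t01; have /andP[t0 t1] := t01.
apply: le_trans (_ : \sum_(k < h + n) t ^+ ((h - k) + (k - h)) <= _).
  rewrite addnC big_split_ord /= lerDl sumr_ge0 // => k _; exact: exprn_ge0.
rewrite big_split_ord /= mulr_natl mulr2n lerD //; last first.
  apply: le_trans (sum_geometric_le n t01); apply: ler_sum => k _.
  by rewrite (_ : _ + _ = k)%N //; lia.
apply: le_trans (sum_geometric_le h t01); rewrite (reindex_inj rev_ord_inj) /=.
by apply: ler_sum => k _; rewrite ler_wiXn2l ?(ltW t1) //; have := ltn_ord k; lia.
Qed.

(** With t^2 as the decay per level, every term is at most a constant times t^(L + |k - h|), where h
    is the integer half of L. The factor t^-2 compensates for the exponent k-1, and summing on both
    sides of h turns 4 into 8. *)
Lemma sum_levels_le (R : realType) (t : R) (L : nat) : 0 < t < 1 -> (2 <= L)%N ->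
  (t ^+ 2) ^+ L.-1 +
    \sum_(1 <= k < L) (if (2 * k <= L)%N then 2 * (t ^+ 2) ^+ (L - k)
                       else 4 * (t ^+ 2) ^+ k.-1) <=
  (1 + 8 * (t ^- 2 * (1 - t)^-1)) * t ^+ L.
Proof.
move=> /andP[t0 t1] L2; have t01 : 0 <= t < 1 by rewrite ltW.
have mono i j : (i <= j)%N -> t ^+ j <= t ^+ i.
  by move=> ij; rewrite ler_wiXn2l ?ltW.
have tV1 : 1 <= t ^- 2 by rewrite invf_ge1 ?exprn_gt0 // exprn_ile1 ?ltW.
rewrite mulrDl mul1r lerD //.
  by rewrite -exprM; apply: mono; lia.
(* With truncated subtraction, the second exponent on the right is the distance from k to the half
   of L. *)
have term k : (if (2 * k <= L)%N then 2 * (t ^+ 2) ^+ (L - k)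
    else 4 * (t ^+ 2) ^+ k.-1) <=
    4 * t ^- 2 * t ^+ L * t ^+ ((L./2 - k) + (k - L./2)).
  have hL := odd_double_half L.
  rewrite -!mulrA -exprD; case: leqP => kL.
    apply: ler_pM; [by [] | by rewrite exprn_ge0 ?sqr_ge0 | by rewrite ler_nat |].
    apply: le_trans (_ : t ^+ (L + (L./2 - k + (k - L./2))) <= _).
      by rewrite -exprM; apply: mono; lia.
    by rewrite ler_peMl ?exprn_ge0 // ltW.
  rewrite ler_wpM2l // [leRHS]mulrC ler_pdivlMr ?exprn_gt0 // -exprSr -exprM.
  by apply: mono; lia.
apply: le_trans (_ : \sum_(k < L) 4 * t ^- 2 * t ^+ L *
    t ^+ ((L./2 - k) + (k - L./2)) <= _).
  rewrite -(big_mkord predT (fun k => 4 * t ^- 2 * t ^+ L *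
    t ^+ ((L./2 - k) + (k - L./2)))) [leRHS]big_ltn ?(ltnW L2) //.
  rewrite -[leLHS]add0r lerD //; last exact: ler_sum.
  by rewrite !mulr_ge0 ?invr_ge0 ?exprn_ge0 ?ltW.
rewrite -mulr_sumr; apply: le_trans (ler_wpM2l _ (sum_exp_dist _ _ t01)) _.
  by rewrite !mulr_ge0 ?invr_ge0 ?exprn_ge0 ?ltW.
by rewrite le_eqVlt; apply/orP; left; apply/eqP; ring.
Qed.

(** * Numbers of points of the rules and of the sparse grid *)

Definition level_exp (R : realType) (p theta : R) (j : nat) : nat :=
  absz (Num.ceil (j%:R * p * theta)).

Lemma level_exp_itv (R : realType) (p theta : R) (j : nat) :
  0 < p -> 0 < theta ->
  j%:R * p * theta <= (level_exp p theta j)%:R < j%:R * p * theta + 1.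
Proof.
move=> p0 t0; have x0 : 0 <= j%:R * p * theta by rewrite !mulr_ge0 // ltW.
have c0 : 0 <= Num.ceil (j%:R * p * theta).
  by rewrite ceil_ge0 (lt_le_trans (ltrN10 R)).
rewrite /level_exp natr_absz ger0_norm // ceil_ge /=.
have /andP[+ _] := ceil_itv (j%:R * p * theta); rewrite intrB mulr1z; lra.
Qed.

Lemma level_exp_gt0 (R : realType) (p theta : R) (j : nat) :
  0 < p -> 0 < theta -> (0 < j)%N -> (0 < level_exp p theta j)%N.
Proof.
move=> p0 t0 j0; have /andP[h _] := level_exp_itv j p0 t0.
by rewrite -(ltr_nat R) (lt_le_trans _ h) // !mulr_gt0 // ltr0n.
Qed.

Lemma level_size_le (R : realType) (b : nat) (p theta : R) (j : nat) :
  (1 < b)%N -> 0 < p -> 0 < theta ->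
  (b ^ level_exp p theta j)%N%:R <= b%:R * b%:R `^ (j%:R * p * theta).
Proof.
move=> b1 p0 t0; have b0 : 0 < b%:R :> R by rewrite ltr0n; lia.
rewrite natrX -powR_mulrn ?(ltW b0) // -{2}[b%:R](powRr1 (ltW b0)) -gt0_powRD //.
rewrite ler_powR ?ler1n ?(ltnW b1) // addrC.
by have /andP[_ /ltW] := level_exp_itv j p0 t0.
Qed.

(** The point counts are balanced so that a rule error of order N^(-1/p) decays by b^-theta per
    level. *)
Lemma level_rate_le (R : realType) (b : nat) (p theta : R) (j : nat) :
  (1 < b)%N -> 0 < p -> 0 < theta ->
  b%:R `^ (- ((level_exp p theta j)%:R / p)) <= (b%:R `^ (- theta)) ^+ j.
Proof.
move=> b1 p0 t0; have b0 : 0 < b%:R :> R by rewrite ltr0n; lia.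
rewrite -powR_mulrn ?powR_ge0 // -powRrM ler_powR ?ler1n ?(ltnW b1) //.
rewrite mulNr lerN2 ler_pdivlMr //.
have -> : theta * j%:R * p = j%:R * p * theta by ring.
by have /andP[] := level_exp_itv j p0 t0.
Qed.

(** The terms decrease geometrically in k with ratio b^(-theta (q - p)). The right-hand factor b^(L
    theta q) is the value the term would have at k = 0. *)
Lemma sum_level_sizes_le (R : realType) (b : R) (p q theta : R) (L : nat) :
  1 < b -> p < q -> 0 < theta ->
  \sum_(1 <= k < L) b `^ (theta * (k%:R * p + (L - k)%:R * q)) <=
  (1 - b `^ (- (theta * (q - p))))^-1 * b `^ (L%:R * theta * q).
Proof.
move=> b1 pq t0; have b0 : 0 < b by apply: lt_trans b1.
set r := theta * (q - p); have r0 : 0 < r by rewrite mulr_gt0 // subr_gt0.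
have s01 : 0 <= b `^ (- r) < 1 by rewrite powR_ge0 powR_lt1 // oppr_lt0.
apply: le_trans (_ : \sum_(k < L) (b `^ (- r)) ^+ k * b `^ (L%:R * theta * q) <= _).
  case: L => [|L]; first by rewrite big_geq // big_ord0.
  rewrite -(big_mkord predT (fun k => (b `^ (- r)) ^+ k * b `^ (L.+1%:R * theta * q))).
  rewrite [leRHS]big_ltn // -[leLHS]add0r lerD //.
    by rewrite mulr_ge0 ?exprn_ge0 ?powR_ge0.
  rewrite !big_nat; apply: ler_sum => k /andP[_ kL].
  rewrite -powR_mulrn ?powR_ge0 // -powRrM -gt0_powRD // ler_powR ?(ltW b1) //.
  rewrite natrB ?(ltnW kL) // le_eqVlt; apply/orP; left; apply/eqP.
  by rewrite /r; ring.
by rewrite -mulr_suml ler_wpM2r ?powR_ge0 ?sum_geometric_le.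
Qed.

(** For distinct p and q the sum is geometric and governed by the larger exponent. For p = q all L -
    1 terms have the same bound, and their number is converted into ln M through M >= b^L. *)
Lemma sparse_grid_size_le (R : realType) (b : nat) (p q theta : R) :
  (1 < b)%N -> 0 < p -> 0 < q -> 0 < theta -> 1 <= p * theta -> 1 <= q * theta ->
  exists2 D : R, 0 < D & forall L, (2 <= L)%N ->
  let M := sparse_grid_size (fun j => b ^ level_exp p theta j)%N
             (fun j => b ^ level_exp q theta j)%N L in
  (0 < M)%N /\
  M%:R <= D * (ln M%:R `^ (p == q)%:R * b%:R `^ (L%:R * theta * Num.max p q)).
Proof.
move=> b1 p0 q0 t0 pt qt; have b0 : 0 < b%:R :> R by rewrite ltr0n; lia.
have b1R : 1 < b%:R :> R by rewrite ltr1n.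
set N1 := fun j : nat => (b ^ level_exp p theta j)%N.
set N2 := fun j : nat => (b ^ level_exp q theta j)%N.
have lnb0 : 0 < ln b%:R :> R by rewrite ln_gt0.
(* Rounding up costs at most a factor b in each of the two point counts. *)
have M_le L : (sparse_grid_size N1 N2 L)%:R <= b%:R ^+ 2 *
    \sum_(1 <= k < L) b%:R `^ (theta * ((L - k)%:R * p + k%:R * q)) :> R.
  rewrite /sparse_grid_size natr_sum mulr_sumr; apply: ler_sum => k _.
  rewrite natrM; apply: le_trans (ler_pM _ _ (level_size_le (L - k) b1 p0 t0)
    (level_size_le k b1 q0 t0)) _ => //.
  by rewrite mulrACA -expr2 -gt0_powRD // mulrDr [theta * _]mulrC [theta * (k%:R * q)]mulrC.
(* The term k = 1 alone suffices: p theta and q theta are at least 1, so level j has at least b^j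
   points. *)
have M_ge L : (2 <= L)%N -> (b ^ L <= sparse_grid_size N1 N2 L)%N.
  move=> L2; rewrite /sparse_grid_size big_ltn //.
  apply: leq_trans (leq_addr _ _); rewrite -expnD leq_exp2l //.
  have h j r : 0 < r -> 1 <= r * theta -> (j <= level_exp r theta j)%N.
    move=> r0 rt; rewrite -(ler_nat R); have /andP[h _] := level_exp_itv j r0 t0.
    by apply: le_trans h; rewrite -mulrA ler_peMr.
  have := h (L - 1)%N p p0 pt; have := h 1%N q q0 qt; lia.
have M_gt0 L : (2 <= L)%N -> (0 < sparse_grid_size N1 N2 L)%N.
  by move=> L2; apply: leq_trans (M_ge L L2); rewrite expn_gt0 (ltnW b1).
have geom0 (r : R) : 0 < r -> 0 < (1 - b%:R `^ (- (theta * r)))^-1.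
  by move=> r0; rewrite invr_gt0 subr_gt0 powR_lt1 // oppr_lt0 mulr_gt0.
have [pq|pq|pq] := ltgtP p q.
- exists (b%:R ^+ 2 * (1 - b%:R `^ (- (theta * (q - p))))^-1) => [|L L2 /=].
    by rewrite mulr_gt0 ?exprn_gt0 ?geom0 ?subr_gt0.
  split; first exact: M_gt0.
  rewrite powRr0 mul1r; apply: le_trans (M_le L) _.
  rewrite -[leRHS]mulrA; apply: ler_wpM2l; first exact: exprn_ge0.
  apply: le_trans (sum_level_sizes_le L b1R pq t0).
  rewrite big_nat_rev /= !big_nat; apply: ler_sum => k /andP[k1 kL].
  by rewrite add1n subSS subKn ?(ltnW kL).
- exists (b%:R ^+ 2 * (1 - b%:R `^ (- (theta * (p - q))))^-1) => [|L L2 /=].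
    by rewrite mulr_gt0 ?exprn_gt0 ?geom0 ?subr_gt0.
  split; first exact: M_gt0.
  rewrite powRr0 mul1r; apply: le_trans (M_le L) _.
  rewrite -[leRHS]mulrA; apply: ler_wpM2l; first exact: exprn_ge0.
  apply: le_trans (sum_level_sizes_le L b1R pq t0).
  by apply: ler_sum => k _; rewrite addrC.
- exists (b%:R ^+ 2 / ln b%:R) => [|L L2 /=].
    by rewrite mulr_gt0 ?exprn_gt0 ?invr_gt0.
  split; first exact: M_gt0.
  apply: le_trans (M_le L) _; rewrite -[leRHS]mulrA.
  apply: ler_wpM2l; first exact: exprn_ge0.
  have lnM : L%:R * ln b%:R <= ln (sparse_grid_size N1 N2 L)%:R :> R.
    rewrite mulr_natl -lnXn // ler_ln ?posrE ?exprn_gt0 ?b0 ?ltr0n ?M_gt0 //.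
    by rewrite -natrX ler_nat M_ge.
  rewrite powRr1; last by apply: le_trans lnM; rewrite mulr_ge0 ?(ltW lnb0).
  rewrite [leRHS]mulrA -pq big_nat.
  under eq_bigr => k /andP[_ kL].
    rewrite -mulrDl -natrD subnK ?(ltnW kL) // mulrA [theta * _]mulrC.
    over.
  rewrite -big_nat sumr_const_nat -[leLHS]mulr_natl ler_wpM2r ?powR_ge0 //.
  rewrite mulrC ler_pdivlMr //; apply: le_trans lnM.
  by rewrite ler_wpM2r ?(ltW lnb0) // ler_nat leq_subr.
Qed.

(** * Error of one rule with respect to the integral *)

Definition grid_digits (b s n : nat) (d : {ffun 'I_s -> 'I_(b ^ n)}) :
    digits b s n :=
  [ffun j => [ffun i => base_digits b n (d j) (rev_ord i)]].

Lemma grid_digits_bij (b s n : nat) : prime b -> bijective (@grid_digits b s n).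
Proof.
move=> pb; apply: inj_card_bij.
  move=> d d' /ffunP dd'; apply/ffunP => j.
  apply: (bij_inj (base_digits_bij n pb)); apply/ffunP => i.
  by have /ffunP/(_ (rev_ord i)) := dd' j; rewrite !ffunE rev_ordK.
by rewrite !card_ffun card_Fp // !card_ord.
Qed.

(** Digits of an integer are indexed from the least significant, those of [gridpt] from the most
    significant, which explains the reversal in [grid_digits]. *)
Lemma gridpt_grid_digits (R : realType) (b s n : nat)
    (d : {ffun 'I_s -> 'I_(b ^ n)}) : prime b ->
  gridpt R (grid_digits d) = cell_corner R d.
Proof.
move=> pb; have b0 : b%:R != 0 :> R by rewrite pnatr_eq0 -lt0n prime_gt0.
apply/rowP => j; rewrite !mxE (reindex_inj rev_ord_inj) /=.
rewrite -[in RHS](@sum_base_digits b n (d j)) ?prime_gt0 // natr_sum mulr_suml.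
apply: eq_bigr => i _; rewrite !ffunE rev_ordK val_Fp_nat // modn_mod.
rewrite natrM !natrX -mulrA; congr (_ * _).
have -> : (b%:R ^+ n : R) = b%:R ^+ i * b%:R ^+ (n - i).
  by rewrite -exprD subnKC // ltnW.
by rewrite invfM mulVKf ?expf_neq0 // subnSK // subKn // ltnW.
Qed.

Lemma mean_gridpt (R : realType) (b s n : nat) (f : 'rV[R]_s -> R) : prime b ->
  #|{: digits b s n}|%:R^-1 * (\sum_(y : digits b s n) f (gridpt R y)) =
  mean (fun d : {ffun 'I_s -> 'I_(b ^ n)} => f (cell_corner R d)).
Proof.
move=> pb; rewrite /mean (bij_eq_card (grid_digits_bij s n pb)); congr (_ * _).
rewrite (reindex _ (onW_bij _ (grid_digits_bij s n pb))) /=.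
by apply: eq_bigr => d _; rewrite gridpt_grid_digits.
Qed.

(** A single difference costs one first-order derivative, bounded by c 1! chi_j. *)
Lemma cube_lipschitz_pderive (R : realType) (s a : nat) (f : 'rV[R]_s -> R)
    (c : R) (chi : nat -> R) :
  (0 < a)%N -> has_mixed_pderives a f ->
  (forall (nu : multi_index s) z, cube z -> (forall j, (nu j <= a)%N) ->
     `|mixed_pderive nu f z| <= c * (mi_abs nu)`!%:R * mi_pow chi nu) ->
  cube_lipschitz f (fun j => c * chi j).
Proof.
move=> a0 sf fB y j h cy h0 cyh.
pose nu0 : multi_index s := [ffun=> 0%N].
have nuE : mi_add_count nu0 [:: (j, h)] = mi_succ nu0 j.
  by apply: mi_ext => i; rewrite !ffunE /= addn0 eq_sym.
have := nabla_bound (l := [:: (j, h)]) (nu := nu0) sf fB _ cy.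
rewrite /= h0 low_corner_cons /low_corner big_nil subr0 => /(_ isT cyh).
rewrite (mixed_pderive0 f (nu := nu0)) => [|i]; last by rewrite ffunE.
rewrite nuE big_seq1 /= => H; apply: le_trans (H _) _.
  by move=> i; rewrite !ffunE; case: eqP.
have -> : mi_abs (mi_succ nu0 j) = 1%N.
  rewrite /mi_abs (bigD1 j) //= big1 => [|i /negPf ij]; rewrite !ffunE ?ij //.
  by rewrite eqxx.
have -> : mi_pow chi (mi_succ nu0 j) = chi j.
  rewrite /mi_pow (bigD1 j) //= big1 => [|i /negPf ij]; rewrite !ffunE ?ij //.
  by rewrite eqxx mulr1.
by rewrite mulr1 mulrC.
Qed.

(** Passing from the fine grid to the integral adds at most c (sum_j chi_j) b^-(m (a+1)). This is
    within the rate b^(-m/p) because p (a+1) > 1, and the sum of the chi_j is bounded in all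
    dimensions by Jensen's inequality. *)
Lemma exists_rule_integral (R : realType) (b a : nat) (p : R) (chi : nat -> R) :
  prime b -> 0 < p < 1 -> 1 < p * a.+1%:R -> (forall j, 0 < chi j) ->
  cvgn (series (fun j => chi j `^ p)) ->
  exists2 C : R, 0 <= C & forall s m, (0 < m)%N ->
  exists x : 'I_(b ^ m) -> 'rV[R]_s,
  [/\ @interlaced_poly_lattice_rule R b a.+1 m s x, forall n, cube (x n) &
   forall (f : 'rV[R]_s -> R) (c : R), has_mixed_pderives a.+1 f ->
   (forall (nu : multi_index s) z, cube z -> (forall j, (nu j <= a.+1)%N) ->
     `|mixed_pderive nu f z| <= c * (mi_abs nu)`!%:R * mi_pow chi nu) ->
   `|cube_integral f - rule_mean x f| <= c * C * b%:R `^ (- (m%:R / p))].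
Proof.
move=> pb p01 pa chi0 chi_cv; have /andP[p0 p1] := p01.
have b1 := prime_gt1 pb.
have b0 : 0 < b%:R :> R by rewrite ltr0n prime_gt0.
have [C C0 hC] := exists_rule pb p01 pa chi0 chi_cv.
set X := limn (series (fun j => chi j `^ p)).
have X_ge s : \sum_(j < s) chi j <= X `^ p^-1.
  have p01' : 0 < p <= 1 by rewrite p0 ltW.
  apply: le_trans (@sum_le_powR R _ predT (fun j : 'I_s => chi j) p p01' _) _ => [j|].
    exact: ltW.
  have hX : \sum_(j < s) chi j `^ p <= X := sum_powR_le_limn s chi_cv.
  have S0 : 0 <= \sum_(j < s) chi j `^ p by rewrite sumr_ge0 // => j _; exact: powR_ge0.
  by rewrite ge0_ler_powR ?nnegrE ?invr_ge0 ?(ltW p0) ?S0 ?(le_trans S0 hX).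
exists (X `^ p^-1 + C) => [|s m m0]; first by rewrite addr_ge0 ?powR_ge0.
have [x [xP cx hx]] := hC s m m0; exists x; split=> // f c sf fB.
have c0 := pderive_bound_ge0 fB.
have := hx f c sf fB; rewrite mean_gridpt // => h2.
have N0 : (0 < b ^ (m * a.+1))%N by rewrite expn_gt0 prime_gt0.
have K0 (j : 'I_s) : 0 <= c * chi j by rewrite mulr_ge0 ?(ltW (chi0 _)).
have h1 := cube_integral_mean N0 (cube_lipschitz_pderive (ltn0Sn a) sf fB) K0.
have -> : rule_mean x f = (b ^ m)%N%:R^-1 * \sum_n f (x n).
  by rewrite /rule_mean /mean card_ord.
have h3 : (\sum_(j < s) c * chi j) * (b ^ (m * a.+1))%N%:R^-1 <=
    c * X `^ p^-1 * b%:R `^ (- (m%:R / p)).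
  apply: ler_pM; rewrite ?invr_ge0 ?sumr_ge0 //.
    by rewrite -mulr_sumr ler_wpM2l.
  rewrite natrX -powR_invn ?(ltW b0) // ler_powR ?ler1n ?prime_gt0 // lerN2.
  rewrite natrM ler_wpM2l // -[p^-1]mul1r ler_pdivrMr // mulrC.
  exact: ltW.
have -> : c * (X `^ p^-1 + C) * b%:R `^ (- (m%:R / p)) =
  c * X `^ p^-1 * b%:R `^ (- (m%:R / p)) + c * (C * b%:R `^ (- (m%:R / p))) by ring.
move: h1 h2 h3; rewrite !ler_norml; lra.
Qed.

Theorem theorem6p2 (R : realType) (b : nat) (p q theta c : R)
    (chi phi : nat -> R) :
  prime b ->
  0 < p < 1 -> 0 < q < 1 ->
  (forall j, 0 < chi j) -> (forall j, 0 < phi j) ->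
  cvgn (series (fun j => chi j `^ p)) ->
  cvgn (series (fun j => phi j `^ q)) ->
  0 < theta -> 1 <= p * theta -> 1 <= q * theta ->
  let alpha := (Num.truncn (1 / p)).+1 in
  let beta := (Num.truncn (1 / q)).+1 in
  let m1 := fun j : nat => absz (Num.ceil (j%:R * p * theta)) in
  let m2 := fun j : nat => absz (Num.ceil (j%:R * q * theta)) in
  let N1 := fun j : nat => (b ^ m1 j)%N in
  let N2 := fun j : nat => (b ^ m2 j)%N in
  exists C C' : R,
  forall s1 s2 : nat, (0 < s1)%N -> (0 < s2)%N ->
  forall F : 'rV[R]_s1 -> 'rV[R]_s2 -> R,
  (forall z, cube z -> has_mixed_pderives alpha (fun y => F y z)) ->
  (forall y, cube y -> has_mixed_pderives beta (F y)) ->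
  (forall y z (nu : multi_index s1), cube y -> cube z ->
     (forall j, (nu j <= alpha)%N) ->
     `|mixed_pderive nu (fun y => F y z) y|
       <= c * ((mi_abs nu)`!)%:R * mi_pow chi nu) ->
  (forall y z (nu : multi_index s2), cube y -> cube z ->
     (forall j, (nu j <= beta)%N) ->
     `|mixed_pderive nu (F y) z|
       <= c * ((mi_abs nu)`!)%:R * mi_pow phi nu) ->
  exists (x : forall j, 'I_(N1 j) -> 'rV[R]_s1)
         (w : forall j, 'I_(N2 j) -> 'rV[R]_s2),
  [/\ forall j, (1 <= j)%N -> @interlaced_poly_lattice_rule R b alpha (m1 j) s1 (x j),
      forall j, (1 <= j)%N -> @interlaced_poly_lattice_rule R b beta (m2 j) s2 (w j) &
      forall L : nat, (2 <= L)%N ->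
      let err := `|integral2 F - sparse_grid x w L F| in
      let M := sparse_grid_size N1 N2 L in
      err <= C * b%:R `^ (- (L%:R * theta / 2)) /\
      err <= C' * ln M%:R `^ ((p == q)%:R / (2 * p))
               * M%:R `^ (- (Num.min (1 / p) (1 / q) / 2))].
Proof.
move=> pb p01 q01 chi0 phi0 chi_cv phi_cv t0 pt qt alpha beta m1 m2 N1 N2.
have [/andP[p0 p1] /andP[q0 q1]] := (p01, q01); have b1 := prime_gt1 pb.
have b0 : 0 < b%:R :> R by rewrite ltr0n prime_gt0.
have order_gt (r : R) : 0 < r -> 1 < r * (Num.truncn (1 / r)).+1%:R.
  by move=> r0; rewrite mulrC -ltr_pdivrMr // truncnS_gt.
have [C1 C10 rule1] := exists_rule_integral pb p01 (order_gt p p0) chi0 chi_cv.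
have [C2 C20 rule2] := exists_rule_integral pb q01 (order_gt q q0) phi0 phi_cv.
have [D D0 sizeD] := sparse_grid_size_le b1 p0 q0 t0 pt qt.
(* Its square is the decay b^-theta of the rule errors per level, and tau^L is the rate to be
   proved. *)
pose tau : R := b%:R `^ (- (theta / 2)).
have tau01 : 0 < tau < 1.
  by rewrite powR_gt0 //= powR_lt1 ?ltr1n // oppr_lt0 divr_gt0.
have tau2 : b%:R `^ (- theta) = tau ^+ 2.
  by rewrite -powR_mulrn ?powR_ge0 // -powRrM; congr (_ `^ _); field.
(* The constants are fixed before F, while c >= 0 follows only from the bounds on F. Hence the
   absolute value. *)
pose A := `|c| * (C1 + C2).
have A0 : 0 <= A by rewrite mulr_ge0 // addr_ge0.
pose E := A * (1 + 8 * (tau ^- 2 * (1 - tau)^-1)).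
have E0 : 0 <= E.
  have /andP[tau0 tau1] := tau01.
  by rewrite mulr_ge0 // addr_ge0 // !mulr_ge0 ?invr_ge0 ?exprn_ge0 ?subr_ge0 // ltW.
pose mu := Num.min (1 / p) (1 / q) / 2.
exists E, (E * D `^ mu) => s1 s2 s10 s20 F sF1 sF2 F1 F2.
have hx j : exists x : 'I_(N1 j) -> 'rV[R]_s1, (0 < j)%N ->
    [/\ @interlaced_poly_lattice_rule R b alpha (m1 j) s1 x,
        forall i, cube (x i) &
        forall z, cube z ->
          `|cube_integral (F^~ z) - rule_mean x (F^~ z)| <= A * (tau ^+ 2) ^+ j].
  (* At level 0 the exponent is 0 and there is no irreducible polynomial of that degree, so a
     constant family serves as a placeholder. *)
  case: (posnP j) => [j0|j0]; first by exists (fun=> 0); rewrite j0.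
  have [x [xP cx hx]] := rule1 s1 _ (level_exp_gt0 p0 t0 j0).
  exists x => _; split=> // z cz.
  have Fz (nu : multi_index s1) y : cube y -> (forall i, (nu i <= alpha)%N) ->
      `|mixed_pderive nu (F^~ z) y| <= c * (mi_abs nu)`!%:R * mi_pow chi nu.
    by move=> cy; exact: F1.
  apply: le_trans (hx _ c (sF1 z cz) Fz) _.
  have c0 := pderive_bound_ge0 Fz.
  rewrite -tau2; apply: ler_pM; rewrite ?powR_ge0 ?mulr_ge0 //.
    by rewrite /A ger0_norm // ler_wpM2l // lerDl.
  exact: level_rate_le.
have hw j : exists w : 'I_(N2 j) -> 'rV[R]_s2, (0 < j)%N ->
    [/\ @interlaced_poly_lattice_rule R b beta (m2 j) s2 w,
        forall i, cube (w i) &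
        forall y, cube y ->
          `|cube_integral (F y) - rule_mean w (F y)| <= A * (tau ^+ 2) ^+ j].
  case: (posnP j) => [j0|j0]; first by exists (fun=> 0); rewrite j0.
  have [w [wP cw hw]] := rule2 s2 _ (level_exp_gt0 q0 t0 j0).
  exists w => _; split=> // y cy.
  have Fy (nu : multi_index s2) z : cube z -> (forall i, (nu i <= beta)%N) ->
      `|mixed_pderive nu (F y) z| <= c * (mi_abs nu)`!%:R * mi_pow phi nu.
    by move=> cz; exact: F2.
  apply: le_trans (hw _ c (sF2 y cy) Fy) _.
  have c0 := pderive_bound_ge0 Fy.
  rewrite -tau2; apply: ler_pM; rewrite ?powR_ge0 ?mulr_ge0 //.
    by rewrite /A ger0_norm // ler_wpM2l // lerDr.
  exact: level_rate_le.
pose x j := sval (cid (hx j)); pose w j := sval (cid (hw j)).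
have xP j := svalP (cid (hx j)); have wP j := svalP (cid (hw j)).
exists x, w; split=> [j j0|j j0|L L2]; first by have [] := xP j j0.
  by have [] := wP j j0.
move=> err M.
have c0 : 0 <= c.
  have cz : cube (0 : 'rV[R]_s2) by move=> j; rewrite mxE lexx ler01.
  apply: (@pderive_bound_ge0 R s1 alpha (F^~ 0) c chi) => nu y cy.
  exact: F1.
have err_le : err <= E * tau ^+ L.
  apply: le_trans (_ : A * ((tau ^+ 2) ^+ L.-1 + \sum_(1 <= k < L)
      (if (2 * k <= L)%N then 2 * (tau ^+ 2) ^+ (L - k)
       else 4 * (tau ^+ 2) ^+ k.-1)) <= _); last first.
    by rewrite /E -mulrA ler_wpM2l ?sum_levels_le.
  have /andP[tau0 tau1] := tau01.
  apply: (@sparse_grid_error R s1 s2 N1 N2 x w F (fun j => c * chi j)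
    (fun j => c * phi j)) => //.
  - by move=> j; rewrite expn_gt0 prime_gt0.
  - by move=> j; rewrite expn_gt0 prime_gt0.
  - by move=> j i j0; have [_ + _] := xP j j0; apply.
  - by move=> j i j0; have [_ + _] := wP j j0; apply.
  - move=> z cz; apply: (cube_lipschitz_pderive _ (sF1 z cz)) => // nu y cy.
    exact: F1.
  - by move=> j; rewrite mulr_ge0 ?(ltW (chi0 _)).
  - move=> y cy; apply: (cube_lipschitz_pderive _ (sF2 y cy)) => // nu z cz.
    exact: F2.
  - by move=> j; rewrite mulr_ge0 ?(ltW (phi0 _)).
  - by move=> j z j0; have [_ _] := xP j j0; apply.
  - by move=> j y j0; have [_ _] := wP j j0; apply.
  - by rewrite exprn_ge0 ?exprn_ile1 ?ltW.
have tauL : tau ^+ L = b%:R `^ (- (L%:R * theta / 2)).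
  by rewrite -powR_mulrn ?powR_ge0 // -powRrM; congr (_ `^ _); field.
split; first by rewrite -tauL.
apply: le_trans err_le _; rewrite -!(mulrA E) ler_wpM2l //.
have [M0 MD] := sizeD L L2; rewrite -/M in M0 MD.
have M0R : 0 < M%:R :> R by rewrite ltr0n.
have lnM0 : 0 <= ln M%:R :> R by rewrite ln_ge0 // ler1n.
pose P := Num.max p q.
have P0 : 0 < P by rewrite lt_max p0.
have muE : mu = (2 * P)^-1.
  rewrite /mu /P; case: (lerP p q) => pq.
    rewrite min_r; first by field; rewrite gt_eqF.
    by rewrite !div1r lef_pV2 ?posrE.
  rewrite min_l; first by field; rewrite gt_eqF.
  by rewrite !div1r lef_pV2 ?posrE // ltW.
have mu0 : 0 <= mu by rewrite muE invr_ge0 mulr_ge0 // ltW.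
(* The bound on M is raised to the power mu = 1/(2 max(p, q)): the factor b^(L theta max(p, q))
   becomes tau^-L and cancels tau^L, leaving D^mu and the logarithmic factor. *)
rewrite -/mu powRN ler_pdivlMr ?powR_gt0 // mulrC.
apply: le_trans (_ : (D * (ln M%:R `^ (p == q)%:R *
    b%:R `^ (L%:R * theta * P))) `^ mu * tau ^+ L <= _).
  rewrite ler_wpM2r ?exprn_ge0 ?powR_ge0 // ge0_ler_powR ?nnegrE //.
  by rewrite !mulr_ge0 ?powR_ge0 // ltW.
rewrite powRM ?(ltW D0) ?mulr_ge0 ?powR_ge0 // powRM ?powR_ge0 //.
rewrite -!mulrA ler_wpM2l ?powR_ge0 //.
have -> : ln M%:R `^ (p == q)%:R `^ mu = ln M%:R `^ ((p == q)%:R / (2 * p)).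
  rewrite -powRrM muE; congr (_ `^ _); rewrite /P.
  by case: eqP => [<-|_]; rewrite ?mul0r // maxxx.
rewrite ler_piMr ?powR_ge0 // tauL -powRrM -gt0_powRD // muE.
rewrite (_ : _ + _ = 0) ?powRr0 //; field; rewrite gt_eqF //.
Qed.
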